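(* Let $B_1,\dots,B_N$ be planar bubbles with colors $\{1,2,3\}$, $n_1,\dots,n_N$ positive integers and $B$ an arbitrary bubble with colors $\{1,2,3\}$. Let $\mathcal{G}_{n_1,\dots,n_N}(B_1,\dots,B_N;B)$ be the set of colored graphs whose bubbles are $n_i$ copies of $B_i$ ($i=1,\dots,N$) together with one marked copy of $B$, and $\mathcal{G}^{\max}_{n_1,\dots,n_N}(B_1,\dots,B_N;B)$ the subset of graphs maximizing $C_0$. Then $G\in\mathcal{G}_{n_1,\dots,n_N}(B_1,\dots,B_N;B)$ belongs to $\mathcal{G}^{\max}_{n_1,\dots,n_N}(B_1,\dots,B_N;B)$ if and only if all its bubbles satisfy the maximal 2-cut property. Moreover the maximal value of $C_0$ over $\mathcal{G}_{n_1,\dots,n_N}(B_1,\dots,B_N;B)$ is $$C_1(B)+\sum_{i=1}^N n_i\bigl(C_1(B_i)-3\bigr).$$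
   Context: Dimension $d=3$. A colored graph (with colors $\{0,1,2,3\}$) is a finite connected bipartite graph (black/white vertices, multiple edges allowed) in which each edge carries a color in $\{0,1,2,3\}$ and every vertex has exactly one incident edge of each color. A bubble is a finite connected bipartite graph with edges colored in $\{1,2,3\}$, each vertex having exactly one incident edge of each color; the bubbles of a colored graph are the connected components after removing the edges of color 0. A bicolored cycle with colors $\{a,b\}$ is a connected component of the subgraph of edges of colors $a,b$. $C_0(G)$ is the number of bicolored cycles of $G$ with colors $\{0,c\}$, $c=1,2,3$. A bubble is planar if its canonical embedding as a combinatorial map (cyclic order $(1,2,3)$ counterclockwise around white vertices, $(1,3,2)$ around black vertices; faces = bicolored cycles) has genus 0. A pairing of a bubble $B$ is a perfect matching $\pi$ between its black and white vertices; adding color-0 edges along $\pi$ gives a colored graph with the single bubble $B$; $\mathcal{G}^{\max}_1(B)$ is the set of pairings maximizing $C_0$ and $C_1(B)$ is that maximal value of $C_0$. A $k$-edge-cut is a set of $k$ edges whose removal disconnects the graph while removing any proper subset does not; it is incident on a bubble $B\subset G$ if all its edges have color 0 and each has exactly one endpoint in $B$. A bubble $B\subset G$ satisfies the maximal 2-cut property if there is $\pi\in\mathcal{G}^{\max}_1(B)$ such that for every vertex $v$ of $B$, either $v$ and $\pi(v)$ are joined by a color-0 edge of $G$, or the two color-0 edges of $G$ incident to $v$ and $\pi(v)$ form a 2-edge-cut incident on $B$. *)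

(* Defs.v *)
From HB Require Import structures.
From mathcomp Require Import all_boot all_order all_algebra.

Set Implicit Arguments.
Unset Strict Implicit.
Unset Printing Implicit Defensive.

Import Order.TTheory GRing.Theory Num.Theory.

(* A finite bipartite multigraph, not necessarily connected, with edges colored
   in D and exactly one edge of each color at each vertex.  Such a graph is the
   same thing as one perfect matching between white and black vertices for each
   color c; the matching is given by the involution [nbr c], mapping a vertex to
   the other endpoint of its edge of color c. *)
Record ecgraph (D : finType) := ECGraph {
  vert :> finType;
  white : pred vert;
  nbr : D -> vert -> vert;
  nbrK : forall c, involutive (nbr c);
  white_nbr : forall c v, white (nbr c v) = ~~ white v
}.

Section Graphs.

Variables (D : finType) (G : ecgraph D).

(* An edge is determined by its color and its white endpoint; parallel edges of
   different colors are distinct. *)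
Definition edge : finType := {p : D * G | white p.2}.

Definition ecol (e : edge) : D := (val e).1.
Definition wend (e : edge) : G := (val e).2.
Definition bend (e : edge) : G := nbr (ecol e) (wend e).

Definition white_end (c : D) (v : G) : G := if white v then v else nbr c v.

Lemma white_white_end c v : white (white_end c v).
Proof. by rewrite /white_end; case: ifP => // /negbT; rewrite white_nbr. Qed.

(* The edge of color c incident to v. *)
Definition edge_at (c : D) (v : G) : edge :=
  exist (fun p : D * G => white p.2) (c, white_end c v) (white_white_end c v).

(* Adjacency in the spanning subgraph with edge set A. *)
Definition adj (A : {set edge}) : rel G :=
  [rel u v | [exists e in A,
     ((u == wend e) && (v == bend e)) || ((u == bend e) && (v == wend e))]].

Definition ncomp (A : {set edge}) : nat := n_comp (adj A) predT.

(* In particular the graph is not empty. *)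
Definition is_connected : Prop := ncomp setT = 1.

Definition n_bicycles (a b : D) : nat := ncomp [set e | ecol e \in [set a; b]].

Definition edge_cut (k : nat) (F : {set edge}) : Prop :=
  [/\ #|F| = k,
      ncomp (~: F) != 1 &
      forall F' : {set edge}, F' \proper F -> ncomp (~: F') = 1].

Lemma adj_edge_at (A : {set edge}) c v :
  edge_at c v \in A -> adj A v (nbr c v).
Proof.
move=> Ae; apply/existsP; exists (edge_at c v); rewrite Ae /=.
rewrite /bend /wend /ecol /= /white_end; case: ifP => _; rewrite ?nbrK !eqxx //.
by rewrite orbT.
Qed.

End Graphs.

Definition isomorphic (D : finType) (G H : ecgraph D) : Prop :=
  exists f : G -> H,
    [/\ bijective f,
        forall v, white (f v) = white v &
        forall c v, f (nbr c v) = nbr c (f v)].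

(* Colors {0,1,2,3} are the elements of 'I_4.  In a 3-colored graph the color
   i : 'I_3 stands for i + 1 in {1,2,3}, i.e. for [lift ord0 i] in 'I_4. *)
Definition C0 (G : ecgraph 'I_4) : nat :=
  \sum_(i < 3) n_bicycles G ord0 (lift ord0 i).

Section Bubbles.

Variable G : ecgraph 'I_4.

(* The vertex set of the bubble of G containing v. *)
Definition bubble (v : G) : {set G} :=
  [set u | connect (adj [set e : edge G | ecol e != ord0]) v u].

Lemma bubble_nbr v u (i : 'I_3) :
  u \in bubble v -> nbr (lift ord0 i) u \in bubble v.
Proof.
rewrite !inE => vu; apply: connect_trans vu (connect1 _).
by apply: adj_edge_at; rewrite inE.
Qed.

Definition bubble_sub_nbr (v : G) (i : 'I_3) (u : {u : G | u \in bubble v}) :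
    {u : G | u \in bubble v} :=
  exist (fun w => w \in bubble v) (nbr (lift ord0 i) (val u))
        (bubble_nbr i (valP u)).

Lemma bubble_sub_nbrK v i : involutive (@bubble_sub_nbr v i).
Proof. by move=> u; apply: val_inj; rewrite /= nbrK. Qed.

Lemma bubble_sub_white v i (u : {u : G | u \in bubble v}) :
  white (val (@bubble_sub_nbr v i u)) = ~~ white (val u).
Proof. exact: white_nbr. Qed.

Definition bubble_graph (v : G) : ecgraph 'I_3 :=
  @ECGraph 'I_3 {u : G | u \in bubble v} (fun u => white (val u))
    (@bubble_sub_nbr v) (@bubble_sub_nbrK v) (@bubble_sub_white v).

Definition incident_on (F : {set edge G}) (S : {set G}) : Prop :=
  forall e, e \in F ->
    ecol e = ord0 /\ (wend e \in S) (+) (bend e \in S).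

End Bubbles.

Section Pairings.

Variable B : ecgraph 'I_3.

(* A perfect matching between white and black vertices, as an involution. *)
Definition is_pairing (pi : {ffun B -> B}) : bool :=
  [forall v, (pi (pi v) == v) && (white (pi v) == ~~ white v)].

Definition pairing : finType := {p : {ffun B -> B} | is_pairing p}.

Definition partner (pi : pairing) : B -> B := val pi.

Definition close_nbr (pi : pairing) (c : 'I_4) : B -> B :=
  if unlift ord0 c is Some i then nbr i else partner pi.

Lemma close_nbrK pi c : involutive (close_nbr pi c).
Proof.
rewrite /close_nbr; case: unlift => [i|] v; first exact: nbrK.
by case/andP: (forallP (valP pi) v) => /eqP.
Qed.

Lemma white_close_nbr pi c v : white (close_nbr pi c v) = ~~ white v.
Proof.
rewrite /close_nbr; case: unlift => [i|]; first exact: white_nbr.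
by case/andP: (forallP (valP pi) v) => _ /eqP.
Qed.

(* The 4-colored graph obtained from B by adding edges of color 0 along pi. *)
Definition close (pi : pairing) : ecgraph 'I_4 :=
  @ECGraph 'I_4 B (@white _ B) (close_nbr pi) (@close_nbrK pi)
    (@white_close_nbr pi).

Definition C1 : nat := \max_(pi : pairing) C0 (close pi).

Definition Gmax1 : {set pairing} := [set pi | C0 (close pi) == C1].

End Pairings.

(* Combinatorial maps: [cm_sigma] turns counterclockwise around the vertices,
   [cm_alpha] exchanges the two darts of an edge, and the faces are the cycles
   of their composite. *)
Record cmap := CMap {
  dart :> finType;
  cm_sigma : dart -> dart;
  cm_alpha : dart -> dart;
  cm_sigma_inj : injective cm_sigma;
  cm_alphaK : involutive cm_alpha;
  cm_alpha_fpf : forall d, cm_alpha d != d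
}.

(* Genus of a connected map, from Euler's formula V - E + F = 2 - 2g. *)
Definition genus (M : cmap) : rat :=
  (1 - ((fcard (@cm_sigma M) predT)%:R - (fcard (@cm_alpha M) predT)%:R
        + (fcard (@cm_sigma M \o @cm_alpha M) predT)%:R) / 2%:R)%R.

Section CanonicalMap.

Variable B : ecgraph 'I_3.

(* The dart (v, c) is the half-edge of color c at v.  The cyclic order is
   (1,2,3) at white vertices and (1,3,2) at black ones.  Composing twice
   [can_sigma \o can_alpha] maps (v, c) to (nbr (c-1) (nbr c v), c) for v white
   and to (nbr (c+1) (nbr c v), c) for v black, so the faces are exactly the
   bicolored cycles of B. *)
Definition can_sigma (d : B * 'I_3) : B * 'I_3 :=
  (d.1, if white d.1 then ordS d.2 else ord_pred d.2).

Definition can_alpha (d : B * 'I_3) : B * 'I_3 := (nbr d.2 d.1, d.2).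

Lemma can_sigma_inj : injective can_sigma.
Proof.
move=> [u c] [v d]; rewrite /can_sigma /= => -[->].
by case: ifP => _ /(congr1 val) /val_inj; [move/(can_inj (@ordSK 3)) |
  move/(can_inj (@ord_predK 3))] => ->.
Qed.

Lemma can_alphaK : involutive can_alpha.
Proof. by case=> v c; rewrite /can_alpha /= nbrK. Qed.

Lemma can_alpha_fpf d : can_alpha d != d.
Proof.
apply/eqP => /(congr1 (fun x => white x.1)) /=.
by rewrite white_nbr; case: white.
Qed.

Definition canonical_map : cmap :=
  CMap can_sigma_inj can_alphaK can_alpha_fpf.

Definition planar : Prop := genus canonical_map = 0%R.

End CanonicalMap.

Definition max_2cut (G : ecgraph 'I_4) (v : G) : Prop :=
  exists2 pi : pairing (bubble_graph v), pi \in Gmax1 (bubble_graph v) &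
    forall u : bubble_graph v,
      let x := val u in
      let y := val (partner pi u) in
      nbr ord0 x = y \/
      (edge_cut 2 [set edge_at ord0 x; edge_at ord0 y] /\
       incident_on [set edge_at ord0 x; edge_at ord0 y] (bubble v)).

Section Class.

Variables (N : nat) (Bs : 'I_N -> ecgraph 'I_3) (n : 'I_N -> nat).
Variable B : ecgraph 'I_3.

(* Labels of the bubbles: [Some (Tagged _ k)] over i is the k-th copy of B_i,
   [None] is the marked copy of B. *)
Definition blabel : Type := option {i : 'I_N & 'I_(n i)}.

Definition model (j : blabel) : ecgraph 'I_3 :=
  if j is Some p then Bs (tag p) else B.

(* [r j] is a vertex chosen in the bubble labelled j; every bubble has exactly
   one label. *)
Definition in_class (G : ecgraph 'I_4) : Prop :=
  is_connected G /\
  exists r : blabel -> G,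
    (forall v : G, exists! j, v \in bubble (r j)) /\
    (forall j, isomorphic (bubble_graph (r j)) (model j)).

Definition in_class_max (G : ecgraph 'I_4) : Prop :=
  in_class G /\ forall G', in_class G' -> C0 G' <= C0 G.

(* m is the maximal value of C_0 over the class; it is attained. *)
Definition max_C0_is (m : int) : Prop :=
  (exists2 G, in_class G & (C0 G)%:Z%R = m) /\
  (forall G, in_class G -> ((C0 G)%:Z <= m)%R).

End Class.

(* Main.v *)
Require Import Defs.
From mathcomp Require Import all_boot all_order all_algebra.
From mathcomp Require Import perm zify fingraph.

Set Implicit Arguments.
Unset Strict Implicit.
Unset Printing Implicit Defensive.

Import GRing.Theory Num.Theory.

(* Write P for the graph of the edges of colors 1, 2, 3 and r for the matching
   of color 0, and let psi r be C_0 - 3 * (number of components of P + r).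
   Flipping r at v, w (rematching v with w and r v with r w) changes each of the
   three numbers of bicolored cycles by at most 1, and raises it if v and w were
   on a common cycle.  The main point (good_planar) is that, if all components
   of P but one are planar, psi is at most its value at some matching s that
   preserves the components of P, and that equality forces r to be reached from
   s by flips that each join two components; these flips are the 2-edge-cuts of
   the statement.  Since psi s = sum (C_1 - 3) for an optimal s, the bound and the
   characterization follow for connected graphs, where there is one component.

   By Euler's formula a planar component of P has a face of length 2 or 4.  If r
   contains an edge v w of P, that pair can be removed from P, which preserves
   planarity and, by submodularity of the rank of graphs, the claim.  A face of
   length 2 produces such an edge, unless a flip improves r.  For a face of
   length 4, if no single flip improves r, then flipping at two opposite edges
   of the face does not decrease psi.  The inductive hypothesis then describes how
   the flipped matching is attached to the component A of the face; in case of
   equality, following the bicolored cycles into the attached parts shows that r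
   already preserves A, and the induction goes on with A discarded. *)

(** * Counting components *)

(** The 3 in psi is the number of colors 1, 2, 3: a flip at two vertices in different components of
    P + r merges one pair of cycles for each color, so it costs three cycles and one component and
    leaves psi unchanged. This makes psi meaningful for disconnected graphs, which the induction
    needs, as removing an edge or discarding a component leads out of the class of connected graphs.
    One component of arbitrary genus is harmless: once r is known to preserve all others, it has to
    preserve that one too. The obstacle is the quadrangle. Its first flip may lower psi by one and
    only the second makes up for it, so the inductive hypothesis speaks of the doubly flipped
    matching and the conclusion has to be carried back to r. This is why the notion proved by
    induction records the case of equality along with the bound. Arguments that follow a cycle
    through a part of the graph are mostly replaced by counting: a set stable under a matching has
    as many white as black vertices, so a cycle that enters a part by a white leg also meets a black
    one. *)

Section Components.

Variable T : finType.
Implicit Types (e : rel T) (S : {set T}).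

(** Counts the components of [e] that meet [S]. For symmetric [e] and closed [S] these are the
    components inside [S], so all subgraphs can live on one vertex type. *)
Definition ncc e S : nat := #|root e @: S|.

Lemma connect_to_closed e S x y :
  (forall u v, u \in S -> e u v -> v \in S) -> connect e x y -> x \in S ->
  y \in S.
Proof.
move=> clS /connectP[p] + ->; elim: p x => //= z p IHp x /andP[exz ep] xS.
by apply: IHp ep (clS _ _ xS exz).
Qed.

Lemma connect_eq_in e e' S :
  (forall u v, u \in S -> e u v -> v \in S) ->
  (forall u v, u \in S -> e u v -> connect e' u v) ->
  forall x y, x \in S -> connect e x y -> connect e' x y.
Proof.
move=> clS sub x y xS exy.
have := @connect_to_closed e [set z in S | connect e' x z] x y _ exy.
rewrite !inE xS connect0 => /(_ _ isT)/andP[]//.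
move=> u v; rewrite !inE => /andP[uS xu] euv; rewrite (clS _ _ uS euv) /=.
exact: connect_trans xu (sub _ _ uS euv).
Qed.

Lemma ncc_imset e e' S :
  connect_sym e' -> (forall x, connect e' x (root e x)) ->
  root e' @: S = root e' @: (root e @: S).
Proof.
move=> sym' sub; rewrite -imset_comp; apply: eq_imset => x /=.
exact/(rootP sym').
Qed.

Lemma leq_ncc e e' S :
  connect_sym e' -> subrel (connect e) (connect e') -> ncc e' S <= ncc e S.
Proof.
move=> sym' sub; rewrite /ncc (@ncc_imset e e') ?leq_imset_card // => x.
by apply: sub; apply: connect_root.
Qed.

(** The map [root e'] sends the [e]-roots of [S] onto the [e']-roots of [S]; a surjection onto a set
    that is at least as large is injective. *)
Lemma eq_ncc_connect e e' S :
  connect_sym e -> connect_sym e' -> subrel (connect e) (connect e') ->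
  ncc e S <= ncc e' S ->
  {in S &, forall x y, connect e' x y -> connect e x y}.
Proof.
move=> sym sym' sub le x y xS yS xy.
have: #|root e' @: (root e @: S)| == #|root e @: S|.
  by rewrite eqn_leq leq_imset_card -ncc_imset // => z; apply/sub/connect_root.
move/imset_injP => inj; apply/(rootP sym)/inj; rewrite ?imset_f //.
have rt z : root e' (root e z) = root e' z.
  by apply/esym/rootP => //; apply/sub/connect_root.
by rewrite !rt; apply/rootP.
Qed.

Lemma ltn_ncc e e' S x y :
  connect_sym e -> connect_sym e' -> subrel (connect e) (connect e') ->
  x \in S -> y \in S -> connect e' x y -> ~~ connect e x y ->
  ncc e' S < ncc e S.
Proof.
move=> sym sym' sub xS yS xy; rewrite ltnNge; apply: contra => le.
exact: (eq_ncc_connect sym sym' sub le).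
Qed.

Lemma eq_ncc e e' S :
  connect_sym e -> connect_sym e' ->
  {in S, forall x y, connect e x y = connect e' x y} -> ncc e S = ncc e' S.
Proof.
move=> sym sym' eqc; rewrite /ncc.
suff -> : root e' @: S = root e' @: (root e @: S).
  rewrite [in RHS]card_in_imset // => _ _ /imsetP[x xS ->] /imsetP[y yS ->].
  have rt z : z \in S -> root e' (root e z) = root e' z.
    by move=> zS; apply/esym/rootP => //; rewrite -eqc // connect_root.
  by rewrite !rt // => /(rootP sym'); rewrite -eqc // => /(rootP sym).
rewrite -imset_comp; apply: eq_in_imset => x xS /=.
by apply/rootP => //; rewrite -eqc // connect_root.
Qed.

Lemma ncc_n_comp e S :
  connect_sym e -> (forall x y, e x y -> x \in S -> y \in S) ->
  ncc e S = n_comp e S.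
Proof.
move=> sym clS; apply: eq_card => x; rewrite !inE.
apply/imsetP/andP => [[y yS ->]|[/eqP rx xS]]; last first.
  by exists x.
rewrite roots_root //; split => //.
apply: connect_to_closed (connect_root e y) yS => u v uS euv.
exact: clS euv uS.
Qed.

(* The hypothesis says that, modulo e, the only edge of e' is ab. *)
Lemma leq_ncc_edge e e' S a b :
  connect_sym e -> connect_sym e' -> subrel (connect e) (connect e') ->
  (forall x y, e' x y -> [|| connect e x y, connect e x a && connect e b y
                           | connect e x b && connect e a y]) ->
  ncc e S <= (ncc e' S).+1.
Proof.
move=> sym sym' sub ed.
pose R x y := [|| connect e x y, connect e x a && connect e b y
                | connect e x b && connect e a y].
have R_trans x y z : R x y -> e' y z -> R x z.
  move=> + /ed; rewrite /R.
  move=> /or3P[xy|/andP[xa bY]|/andP[xb aY]] /or3P[yz|/andP[ya bz]|/andP[yb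
    az]].
  - by rewrite (connect_trans xy yz).
  - by rewrite (connect_trans xy ya) bz orbT.
  - by rewrite (connect_trans xy yb) az !orbT.
  - by rewrite xa (connect_trans bY yz) orbT.
  - by rewrite xa bz orbT.
  - by rewrite (connect_trans xa az).
  - by rewrite xb (connect_trans aY yz) !orbT.
  - by rewrite (connect_trans xb bz).
  - by rewrite xb az !orbT.
have RP x y : connect e' x y -> R x y.
  move=> xy; have := @connect_to_closed e' [set z | R x z] x y _ xy.
  have Rxx : R x x by rewrite /R connect0.
  by rewrite !inE => -> // u v; rewrite !inE; apply: R_trans.
(* Only the classes of [a] and [b] can merge, so [root e'] is injective on the classes other than
   that of [b]. *)
pose S0 := (root e @: S) :\ root e b.
have le1 : #|S0| <= ncc e' S.
  rewrite /ncc (@ncc_imset e e') => //; last by move=> x;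
    apply/sub/connect_root.
  rewrite -(@card_in_imset _ _ (root e') S0);
    first exact/subset_leq_card/imsetS/subsetDl.
  move=> x' y' /setD1P[xb /imsetP[x xS ex]] /setD1P[yb /imsetP[y yS ey]].
  subst x' y'.
  have rt z : root e' (root e z) = root e' z.
    by apply/esym/rootP => //; apply/sub/connect_root.
  rewrite !rt => /(rootP sym')/RP/or3P[/(rootP sym)//|/andP[_]|/andP[]].
    by rewrite sym => /(rootP sym) yb'; rewrite yb' eqxx in yb.
  by move=> /(rootP sym) xb'; rewrite xb' eqxx in xb.
apply: leq_trans (_ : #|S0|.+1 <= _); last by rewrite ltnS.
by rewrite /ncc (cardsD1 (root e b)) -/S0; case: (_ \in _);
  rewrite ?add1n ?add0n.
Qed.

Definition add_edge (ab : T * T) e : rel T :=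
  fun x y => [|| e x y,
    (x == ab.1) && (y == ab.2) | (x == ab.2) && (y == ab.1)].

Definition add_edges es e : rel T := foldr add_edge e es.

Lemma add_edges_sym es e : symmetric e -> symmetric (add_edges es e).
Proof.
move=> sym; elim: es => //= ab es IH x y; rewrite /add_edge IH.
by congr (_ || _); rewrite orbC; congr (_ || _); rewrite andbC.
Qed.

Lemma sub_add_edge ab e : subrel (connect e) (connect (add_edge ab e)).
Proof.
apply: connect_sub => x y exy; apply: connect1.
by rewrite /add_edge exy.
Qed.

Lemma add_edge_connect ab e : connect (add_edge ab e) ab.1 ab.2.
Proof. by apply: connect1; rewrite /add_edge !eqxx orbT. Qed.

Lemma leq_ncc_add_edge ab e S : symmetric e ->
  ncc e S <= ncc (add_edge ab e) S + ~~ connect e ab.1 ab.2.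
Proof.
move=> syme; have sym := sym_connect_sym syme.
have sym' : connect_sym (add_edge ab e).
  exact/sym_connect_sym/(@add_edges_sym [:: ab]).
case: (boolP (connect e ab.1 ab.2)) => con /=; rewrite ?addn0 ?addn1.
  apply: leq_ncc => //; apply: connect_sub => x y.
  case/or3P=> [/connect1//|/andP[/eqP-> /eqP->]//|/andP[/eqP-> /eqP->]].
  by rewrite sym.
apply: (@leq_ncc_edge _ _ _ ab.1 ab.2) => //; first exact: sub_add_edge.
move=> x y /or3P[/connect1->//|/andP[/eqP-> /eqP->]|/andP[/eqP-> /eqP->]];
  by rewrite !connect0 !orbT.
Qed.

Lemma ncc_add_edge ab e : symmetric e ->
  ncc e setT = ncc (add_edge ab e) setT + ~~ connect e ab.1 ab.2.
Proof.
move=> syme; have sym := sym_connect_sym syme.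
have sym' : connect_sym (add_edge ab e).
  exact/sym_connect_sym/(@add_edges_sym [:: ab]).
apply/eqP; rewrite eqn_leq leq_ncc_add_edge //=.
case: (boolP (connect e ab.1 ab.2)) => con; rewrite ?addn0 ?addn1.
  by apply: leq_ncc => //; apply: sub_add_edge.
apply: (@ltn_ncc _ _ _ ab.1 ab.2) => //; first exact: sub_add_edge.
exact: add_edge_connect.
Qed.

(** Submodularity of the graphic rank, one edge at a time: an edge that joins two components of the
    coarser relation also joins two components of the finer one. *)
Lemma ncc_add_edges_submod es e e' :
  symmetric e -> symmetric e' -> subrel (connect e) (connect e') ->
  ncc e' setT + ncc (add_edges es e) setT
    <= ncc e setT + ncc (add_edges es e') setT.
Proof.
move=> sym sym' sub.
suff [] : ncc e' setT + ncc (add_edges es e) setT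
    <= ncc e setT + ncc (add_edges es e') setT /\
    subrel (connect (add_edges es e)) (connect (add_edges es e')) by [].
elim: es => [|ab es [IH1 IH2]] /=; first by rewrite addnC.
split; last first.
  apply: connect_sub => x y /or3P[/connect1/IH2/sub_add_edge//||].
    by move=> /andP[/eqP-> /eqP->]; apply: add_edge_connect.
  move=> /andP[/eqP-> /eqP->].
  rewrite (sym_connect_sym (add_edges_sym (ab :: es) sym')).
  exact: add_edge_connect.
have := ncc_add_edge ab (add_edges_sym es sym).
have := ncc_add_edge ab (add_edges_sym es sym').
have : ~~ connect (add_edges es e') ab.1 ab.2 ->
       ~~ connect (add_edges es e) ab.1 ab.2 by apply: contra => /IH2.
by do 2!case: connect => /=; lia.
Qed.

Lemma leq_ncc_add_edges es e S : symmetric e ->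
  ncc e S <= ncc (add_edges es e) S + size es.
Proof.
move=> sym; elim: es => [|ab es IH] /=; first by rewrite addn0.
have := leq_ncc_add_edge ab S (add_edges_sym es sym); rewrite -/(add_edges _ _).
by case: (~~ _) => /=; lia.
Qed.

Lemma ncc_set0 e : ncc e set0 = 0.
Proof. by rewrite /ncc imset0 cards0. Qed.

Lemma ncc_setU e S S' : connect_sym e ->
  (forall x y, x \in S -> e x y -> y \in S) -> [disjoint S & S'] ->
  ncc e (S :|: S') = ncc e S + ncc e S'.
Proof.
move=> sym clS dis; rewrite /ncc imsetU cardsU -[RHS]subn0; congr (_ - _).
apply/eqP; rewrite cards_eq0 -subset0; apply/subsetP => z.
rewrite !inE => /andP[/imsetP[x xS ->] /imsetP[y yS' /(rootP sym) xy]].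
by rewrite (disjointFr dis (connect_to_closed clS xy xS)) in yS'.
Qed.

Lemma ncc_partition (J : finType) (lab : T -> J) e S :
  connect_sym e -> (forall x y, e x y -> lab x = lab y) ->
  ncc e S = \sum_j ncc e [set x in S | lab x == j].
Proof.
move=> sym labe.
have labc x y : connect e x y -> lab x = lab y.
  move=> /(connect_to_closed (S := [set z | lab x == lab z])).
  rewrite !inE eqxx => H; apply/eqP/H => // u v.
  by rewrite !inE => /eqP-> /labe->.
have labr x : lab (root e x) = lab x by rewrite -(labc _ _ (connect_root e x)).
rewrite /ncc -sum1_card (partition_big lab predT) //=.
apply: eq_bigr => j _; rewrite -sum1_card; apply: eq_bigl => x.
apply/andP/imsetP => [[/imsetP[y yS ->]]|[y]].
  by rewrite labr => yj; exists y; rewrite ?inE ?yS.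
by rewrite inE => /andP[yS yj] ->; rewrite labr imset_f.
Qed.

Lemma ncc_connected e S : connect_sym e ->
  (exists x, x \in S) -> {in S &, forall x y, connect e x y} -> ncc e S = 1.
Proof.
move=> sym [x xS] con; apply/eqP/cards1P; exists (root e x).
apply/setP => y; rewrite inE; apply/imsetP/eqP => [[z zS ->]|->];
  last by exists x.
by apply/rootP => //; apply: con.
Qed.

Lemma ncc1_connected e : connect_sym e -> ncc e setT = 1 ->
  forall x y, connect e x y.
Proof.
move=> sym /eqP/cards1P[z ez] x y; apply/(rootP sym).
by have := imset_f (root e) (in_setT x); have := imset_f (root e) (in_setT y);
  rewrite ez !inE => /eqP-> /eqP->.
Qed.

End Components.

(** * Matchings and flips *)

Section Matchings.

Variables (V : finType) (white : pred V).

Record matching := Matching {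
  match_fun :> V -> V;
  matchK : involutive match_fun;
  white_match : forall x, white (match_fun x) = ~~ white x
}.

Implicit Types (f r s : matching) (Y : {set V}).

Lemma match_inj r : injective r. Proof. exact: inv_inj (@matchK r). Qed.

Definition stable (h : V -> V) Y : Prop := forall x, x \in Y -> h x \in Y.

Lemma stable_mem r Y x : stable r Y -> (r x \in Y) = (x \in Y).
Proof. by move=> st; apply/idP/idP => /st //; rewrite matchK. Qed.

Section Families.

Variables (I : finType) (F : I -> matching).

Definition graph : rel V := fun x y => [exists i, F i x == y].

Lemma graph_sym : symmetric graph.
Proof.
by move=> x y; apply/existsP/existsP => -[i /eqP<-]; exists i; rewrite matchK.
Qed.

Definition conn := connect graph.

Lemma conn_sym : connect_sym graph.
Proof. exact: sym_connect_sym graph_sym. Qed.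

Lemma conn_refl x : conn x x. Proof. exact: connect0. Qed.

Lemma conn_trans x y z : conn x y -> conn y z -> conn x z.
Proof. exact: connect_trans. Qed.

Lemma conn_step i x : conn x (F i x).
Proof. by apply: connect1; apply/existsP; exists i. Qed.

Lemma conn_stable Y x y :
  (forall i, stable (F i) Y) -> conn x y -> (x \in Y) = (y \in Y).
Proof.
move=> st xy.
have cl u v : u \in Y -> graph u v -> v \in Y.
  by move=> uY /existsP[i /eqP<-]; apply: st.
have yx : conn y x by rewrite /conn conn_sym.
by apply/idP/idP; [apply: connect_to_closed xy | apply: connect_to_closed yx].
Qed.

Definition component x : {set V} := [set y | conn x y].

Lemma mem_component x : x \in component x. Proof. by rewrite inE conn_refl. Qed.

Lemma component_stable i x : stable (F i) (component x).
Proof. by move=> y; rewrite !inE => /conn_trans; apply; apply: conn_step. Qed.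

Definition comps Y := ncc graph Y.

End Families.

Lemma sub_conn (I J : finType) (F : I -> matching) (G : J -> matching) :
  (forall i x, conn G x (F i x)) -> subrel (conn F) (conn G).
Proof. by move=> sub; apply: connect_sub => x y /existsP[i /eqP<-]; apply: sub.
Qed.

Lemma eq_graph (I : finType) (F G : I -> matching) :
  (forall i, F i =1 G i) -> graph F =2 graph G.
Proof. by move=> eqFG x y; apply: eq_existsb => i; rewrite eqFG. Qed.

Lemma eq_conn (I : finType) (F G : I -> matching) :
  (forall i, F i =1 G i) -> conn F =2 conn G.
Proof. by move=> eqFG; apply/eq_connect/eq_graph. Qed.

Lemma eq_comps_in (I J : finType) (F : I -> matching) (G : J -> matching) Y :
  {in Y, forall x y, conn F x y = conn G x y} -> comps F Y = comps G Y.
Proof. by move=> eqc; apply: eq_ncc => //; apply: conn_sym. Qed.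

Lemma conn_agree (I : finType) (F G : I -> matching) Y :
  (forall i, stable (F i) Y) -> (forall i, {in Y, F i =1 G i}) ->
  {in Y, forall x y, conn F x y = conn G x y}.
Proof.
move=> st ag x xY y; apply/idP/idP; apply: connect_eq_in xY => u v uY.
- by move=> /existsP[i /eqP<-]; apply: st.
- by move=> /existsP[i /eqP<-]; rewrite ag //; apply: conn_step.
- by move=> /existsP[i /eqP<-]; rewrite -ag //; apply: st.
- by move=> /existsP[i /eqP<-]; rewrite -ag //; apply: conn_step.
Qed.

(** With [option I] as index type, P + r is again a family of matchings, and everything about [conn]
    and [comps] applies to it. *)
Definition extend (I : finType) (F : I -> matching) r (o : option I) :=
  if o is Some i then F i else r.

Definition pair_of f r := extend (fun _ : unit => f) r.

Definition cycles f r Y := comps (pair_of f r) Y.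

Lemma conn_extendl (I : finType) (F : I -> matching) r i x :
  conn (extend F r) x (F i x).
Proof. exact: (conn_step (extend F r) (Some i)). Qed.

Lemma conn_extendr (I : finType) (F : I -> matching) r x :
  conn (extend F r) x (r x).
Proof. exact: (conn_step (extend F r) None). Qed.

Lemma sub_conn_extend (I : finType) (F : I -> matching) r :
  subrel (conn F) (conn (extend F r)).
Proof. by apply: sub_conn => i x; apply: conn_extendl. Qed.

Lemma conn_extend_stable (I : finType) (F : I -> matching) r Y x y :
  (forall i, stable (F i) Y) -> stable r Y -> conn (extend F r) x y ->
  (x \in Y) = (y \in Y).
Proof. by move=> sF sr; apply: conn_stable => -[i|]; [apply: sF | apply: sr].
Qed.

Lemma sub_conn_pair_of (I : finType) (F : I -> matching) r i :
  subrel (conn (pair_of (F i) r)) (conn (extend F r)).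
Proof.
by apply: sub_conn => -[[]|] x; [apply: conn_extendl | apply: conn_extendr].
Qed.

Lemma conn_pair_ofC f r : conn (pair_of f r) =2 conn (pair_of r f).
Proof.
move=> x y; apply/idP/idP; apply: sub_conn => -[[]|] {}x;
  by [apply: conn_extendl | apply: conn_extendr].
Qed.

Lemma cyclesC f r Y : cycles f r Y = cycles r f Y.
Proof. by apply: eq_comps_in => x _ y; apply: conn_pair_ofC. Qed.

Lemma eq_cycles f f' r r' Y : stable f Y -> stable r Y ->
  {in Y, f =1 f'} -> {in Y, r =1 r'} -> cycles f r Y = cycles f' r' Y.
Proof.
move=> sf sr eqf eqr; apply: eq_comps_in; by apply: conn_agree => -[[]|] //=.
Qed.

Section Flip.

Variables (r : matching) (v w : V).

(* If v and w have opposite colors, this rematches v with w and r v with r w;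
   otherwise it is r. *)
Definition flip_fun (x : V) : V :=
  if white v == white w then r x else tperm v (r w) (r (tperm v (r w) x)).

Lemma flip_funK : involutive flip_fun.
Proof.
by move=> x; rewrite /flip_fun; case: eqP => _; rewrite ?tpermK matchK ?tpermK.
Qed.

Lemma white_flip_fun x : white (flip_fun x) = ~~ white x.
Proof.
rewrite /flip_fun; case: ifP => [_|/eqP/eqP hvw]; first exact: white_match.
have tw y : white (tperm v (r w) y) = white y.
  by case: tpermP => // ->; rewrite white_match;
    case: (white v) (white w) hvw => [] [].
by rewrite tw white_match tw.
Qed.

Definition flip := Matching flip_funK white_flip_fun.
Arguments flip : simpl never.

Hypothesis hvw : white v != white w.

Lemma flipE x : flip x = tperm v (r w) (r (tperm v (r w) x)).
Proof. by rewrite /flip /= /flip_fun (negbTE hvw). Qed.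

Lemma opp_color x y : white x != white y -> x != y.
Proof. by apply: contra => /eqP->. Qed.

Lemma flipl : flip v = w.
Proof.
rewrite flipE tpermL matchK tpermD ?opp_color //.
by rewrite white_match; case: (white w).
Qed.

Lemma flipr : flip w = v. Proof. by rewrite -[w in LHS]flipl matchK. Qed.

Lemma flip_nbrl : flip (r v) = r w.
Proof.
rewrite flipE [tperm _ _ (r v)]tpermD ?matchK ?tpermL ?opp_color //.
  by rewrite white_match; case: (white v).
by rewrite !white_match; case: (white v) (white w) hvw => [] [].
Qed.

Lemma flip_nbrr : flip (r w) = r v.
Proof. by rewrite -flip_nbrl matchK. Qed.

Lemma flip_other x : x != v -> x != w -> x != r v -> x != r w -> flip x = r x.
Proof.
move=> xv xw xrv xrw; rewrite flipE (@tpermD _ v _ x) 1?eq_sym // tpermD //.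
  by apply: contra xrv => /eqP->; rewrite matchK.
by rewrite (inj_eq (@match_inj r)) eq_sym.
Qed.

Variant flip_spec x : V -> Prop :=
| FlipL of x = v : flip_spec x w
| FlipR of x = w : flip_spec x v
| FlipNbrL of x = r v : flip_spec x (r w)
| FlipNbrR of x = r w : flip_spec x (r v)
| FlipOther of x != v & x != w & x != r v & x != r w : flip_spec x (r x).

Lemma flipP x : flip_spec x (flip x).
Proof.
have [->|xv] := eqVneq x v; first by rewrite flipl; apply: FlipL.
have [->|xw] := eqVneq x w; first by rewrite flipr; apply: FlipR.
have [->|xrv] := eqVneq x (r v); first by rewrite flip_nbrl; apply: FlipNbrL.
have [->|xrw] := eqVneq x (r w); first by rewrite flip_nbrr; apply: FlipNbrR.
by rewrite flip_other //; apply: FlipOther.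
Qed.

Lemma flip_id : r v = w -> flip =1 r.
Proof. by move=> rv x; case: flipP => [->|->|->|->|] //; rewrite -rv !matchK.
Qed.

Lemma flip_stable Y : stable r Y -> (v \in Y) = (w \in Y) -> stable flip Y.
Proof.
move=> st vw x; case: flipP => [->|->|->|->|_ _ _ _ /st //];
  by rewrite ?stable_mem // ?vw // -?vw.
Qed.

Section FlipConn.

Variables (I : finType) (F : I -> matching).

Lemma sub_conn_flip : conn (extend F r) v w ->
  subrel (conn (extend F flip)) (conn (extend F r)).
Proof.
move=> vw; apply: sub_conn => -[i|] x; first exact: conn_extendl.
rewrite [extend _ _ _]/=.
have wv : conn (extend F r) w v by rewrite /conn conn_sym.
have nb y : conn (extend F r) (r y) y by rewrite /conn conn_sym;
  apply: conn_extendr.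
case: flipP => [->|->|->|->|_ _ _ _] //; last exact: conn_extendr.
- by apply: conn_trans (conn_trans (nb v) vw) _; apply: conn_extendr.
- by apply: conn_trans (conn_trans (nb w) wv) _; apply: conn_extendr.
Qed.

(** The flip links [v] to [w] and [r v] to [r w]; if [v] is still connected to [r v], all four
    vertices are, and no connection of [r] is lost. *)
Lemma sub_conn_unflip : conn (extend F flip) v (r v) ->
  subrel (conn (extend F r)) (conn (extend F flip)).
Proof.
move=> vrv; apply: sub_conn => -[i|] x; first exact: conn_extendl.
rewrite [extend _ _ _]/=.
have st := conn_extendr F flip; have stV y : conn (extend F flip) (flip y) y.
  by rewrite /conn conn_sym; apply: conn_extendr.
have wrw : conn (extend F flip) w (r w).
  rewrite -flip_nbrl -[w in conn _ w]flipl.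
  exact: conn_trans (stV v) (conn_trans vrv (st _)).
have sy := conn_sym (extend F flip).
have [->|xv] := eqVneq x v; first by [].
have [->|xw] := eqVneq x w; first by [].
have [->|xrv] := eqVneq x (r v); first by rewrite matchK /conn sy.
have [->|xrw] := eqVneq x (r w); first by rewrite matchK /conn sy.
by rewrite -flip_other.
Qed.

(** Both matchings together. Modulo F + r this adds only the edge from [v] to [w], modulo the
    flipped graph only the edge from [v] to [r v]; comparing both graphs with [U] shows that a flip
    changes the number of components by at most one. *)
Let U := extend (extend F r) flip.

Lemma leq_comps_flip Y : comps (extend F r) Y <= (comps (extend F flip) Y).+1.
Proof.
apply: (@leq_trans (comps U Y).+1); last first.
  rewrite ltnS; apply: leq_ncc; first exact: conn_sym.
  apply: sub_conn => -[i|] x; first exact: (conn_extendl _ _ (Some i)).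
  exact: conn_extendr.
have st := conn_extendr F r.
apply: (@leq_ncc_edge _ _ _ _ v w); try exact: conn_sym.
  exact: sub_conn_extend.
have st' y : conn (extend F r) (r y) y by rewrite /conn conn_sym; apply: st.
move=> x _ /existsP[o /eqP<-]; rewrite -!/(conn _ _ _); case: o => [[i|]|].
- by rewrite (conn_extendl F r i).
- by rewrite (conn_extendr F r).
- rewrite -[U _ x]/(flip x).
  by case: (flipP x) => [->|->|->|->|_ _ _ _];
    rewrite ?(conn_refl, st, st', orbT).
Qed.

Lemma leq_comps_unflip Y : comps (extend F flip) Y <= (comps (extend F r) Y).+1.
Proof.
apply: (@leq_trans (comps U Y).+1); last first.
  rewrite ltnS; apply: leq_ncc; first exact: conn_sym.
  exact: sub_conn_extend.
have st := conn_extendr F flip.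
have sy x y : conn (extend F flip) x y = conn (extend F flip) y x.
  by rewrite /conn conn_sym.
apply: (@leq_ncc_edge _ _ _ _ v (r v)); try exact: conn_sym.
  apply: sub_conn => -[i|] x; first exact: (conn_extendl _ _ (Some i)).
  exact: conn_extendr.
have wv : conn (extend F flip) w v by rewrite -[X in conn _ _ X]flipr.
have rr : conn (extend F flip) (r v) (r w)
  by rewrite -[X in conn _ _ X]flip_nbrl.
move=> x _ /existsP[o /eqP<-]; rewrite -!/(conn _ _ _); case: o => [[i|]|].
- by rewrite (conn_extendl F flip i).
- rewrite -[U _ x]/(r x).
  have [->|xv] := eqVneq x v; first by rewrite !conn_refl !orbT.
  have [->|xw] := eqVneq x w; first by rewrite wv rr !orbT.
  have [->|xrv] := eqVneq x (r v); first by rewrite matchK !conn_refl !orbT.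
  have [->|xrw] := eqVneq x (r w).
    by rewrite matchK ![conn _ _ (r v)]sy [conn _ v w]sy rr wv !orbT.
  by rewrite -(flip_other xv) // st.
- by rewrite (conn_extendr F flip).
Qed.

Lemma ltn_comps_flip Y :
  conn (extend F r) v w -> ~~ conn (extend F flip) v (r v) ->
  v \in Y -> r v \in Y -> comps (extend F r) Y < comps (extend F flip) Y.
Proof.
move=> vw nvrv vY rvY; apply: (@ltn_ncc _ _ _ _ v (r v)) => //;
  try exact: conn_sym.
- exact: sub_conn_flip.
- exact: conn_extendr.
Qed.

End FlipConn.

(* Following the cycle of v in {f, r}, starting with the r-edge, until w is
   reached yields a set that is closed under f and the flip but avoids v. *)
Lemma flip_splits f : r v != w -> conn (pair_of f r) v w ->
  ~~ conn (pair_of f flip) v (r v).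
Proof.
move=> rvw vw; pose g x := f (r x).
have injg : injective g by move=> x y /match_inj/match_inj.
have wg x : white (g x) = white x by rewrite !white_match negbK.
have symg := fconnect_sym injg.
have wgc x : fconnect g v x -> white x = white v.
  move=> vx; have := @connect_to_closed _ (frel g) [set z | white z == white v]
    v x.
  rewrite !inE eqxx => H; apply/eqP; apply: H => // a b.
  by rewrite !inE => + /eqP<-; rewrite wg.
(* The orbit of [v] under [g] and its [r]-images form a set closed under [f] and [r], which
   therefore contains [w]; by its color [w] is one of the [r]-images. *)
have vrw : fconnect g v (r w).
  pose Z := [set x | fconnect g v x || fconnect g v (r x)].
  have : (v \in Z) = (w \in Z).
    apply: conn_extend_stable vw => [_|] x; rewrite !inE; last first.
      by rewrite matchK orbC.
    case/orP => [vx|vrx]; last first.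
      by apply/orP; left; apply: connect_trans vrx (connect1 _);
        rewrite /= /g matchK.
    apply/orP; right; by rewrite symg (same_fconnect1 injg) {2}/g !matchK symg.
  rewrite !inE connect0 => /esym/orP[/wgc ww|//].
  by have := hvw; rewrite ww eqxx.
pose j := findex g v (r w); have jo : j < order g v by apply: findex_max.
have ej : iter j g v = r w by apply: iter_findex.
have i0 i : i <= j -> iter i g v = v -> i = 0.
  move=> ij e; have := findex_iter (leq_ltn_trans ij jo).
  by rewrite e findex0.
have inotrw i : i < j -> iter i g v != r w.
  move=> ij; apply/eqP => e; have := findex_iter (ltn_trans ij jo).
  by rewrite e -/j => eij; rewrite eij ltnn in ij.
have wi i : white (iter i g v) = white v by elim: i => //= i <-; rewrite wg.
have j_gt0 : 0 < j.
  case: (posnP j) => // j0; have := ej; rewrite j0 /= => e.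
  by rewrite e matchK eqxx in rvw.
pose Y := [set y | [exists i : 'I_j,
  (y == iter i.+1 g v) || (y == r (iter i g v))]].
apply/negP => con.
have /esym : (v \in Y) = (r v \in Y).
  apply: conn_extend_stable con => [_|] y.
    rewrite !inE => /existsP[i /orP[/eqP->|/eqP->]].
      by apply/existsP; exists i; rewrite /= /g matchK eqxx orbT.
    by apply/existsP; exists i; rewrite /= eqxx.
  rewrite !inE => /existsP[i /orP[/eqP->|/eqP->]]; apply/existsP.
    have [ij|] := ltnP i.+1 j.
      exists (Ordinal ij); rewrite flip_other ?eqxx ?orbT ?inotrw //.
      - by apply/eqP => /i0; rewrite ltn_ord => /(_ isT).
      - by apply: opp_color; rewrite wi.
      - by apply: opp_color; rewrite wi white_match; case: (white v).
    move=> ji; have -> : i.+1 = j by apply/eqP; rewrite eqn_leq ltn_ord ji.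
    by exists (Ordinal j_gt0); rewrite ej flip_nbrr eqxx orbT.
  have [i_0|i_gt0] := posnP i.
    have j1 : j.-1 < j by rewrite prednK.
    exists (Ordinal j1); have -> : (Ordinal j1).+1 = j by exact: prednK.
    by rewrite i_0 [iter 0 _ _]/= flip_nbrl ej eqxx.
  have i1 : i.-1 < j by apply: leq_ltn_trans (leq_pred i) (ltn_ord i).
  exists (Ordinal i1); have -> : (Ordinal i1).+1 = i by exact: prednK.
  rewrite flip_other ?matchK ?eqxx //.
  - by apply: opp_color; rewrite white_match wi; case: (white v).
  - by rewrite -(inj_eq (@match_inj r)) matchK inotrw.
  - rewrite (inj_eq (@match_inj r)); apply/eqP => /i0.
    by rewrite (ltnW (ltn_ord i)) => /(_ isT) ii; rewrite ii in i_gt0.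
  - apply: opp_color; rewrite !white_match wi;
      case: (white v) (white w) hvw => [] [] //.
have -> : r v \in Y.
  by rewrite inE; apply/existsP; exists (Ordinal j_gt0); rewrite /= eqxx orbT.
suff /negbTE-> : v \notin Y by [].
rewrite inE; apply/existsPn => i; apply/norP; split.
  by apply/eqP => /esym/i0; rewrite ltn_ord => /(_ isT).
by apply: opp_color; rewrite white_match wi; case: (white v).
Qed.

Lemma ltn_cycles_flip f Y : r v != w -> conn (pair_of f r) v w ->
  v \in Y -> r v \in Y -> cycles f r Y < cycles f flip Y.
Proof. by move=> rvw vw; apply: ltn_comps_flip => //; apply: flip_splits. Qed.

End Flip.

Arguments flip : simpl never.

Definition whites Y := [set x in Y | white x].
Definition blacks Y := [set x in Y | ~~ white x].

Lemma card_whites_blacks r Y : stable r Y -> #|whites Y| = #|blacks Y|.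
Proof.
move=> st; rewrite -(card_imset _ (@match_inj r)); apply: eq_card => x.
rewrite !inE; apply/imsetP/andP => [[y]|[xY bx]].
  by rewrite inE => /andP[yY wy] ->; rewrite st // white_match negbK.
by exists (r x); rewrite ?matchK // inE st // white_match.
Qed.

Lemma stableI (h : V -> V) Y Y' : stable h Y -> stable h Y' ->
  stable h (Y :&: Y').
Proof. by move=> st st' x; rewrite !inE => /andP[/st-> /st'->]. Qed.

Lemma stableC r Y : stable r Y -> stable r (~: Y).
Proof. by move=> st x; rewrite !inE stable_mem. Qed.

Lemma stableD r Y Y' : stable r Y -> stable r Y' -> stable r (Y :\: Y').
Proof. by move=> st st'; rewrite setDE; apply: stableI => //; apply: stableC.
Qed.

(** The matching [r] balances the colors in [C :&: M] and [f] those in [C :&: Y]; the difference is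
    balanced as well. *)
Lemma balance f r (C M Y : {set V}) :
  stable r M -> stable f Y -> Y \subset M -> stable f C -> stable r C ->
  #|whites (C :&: (M :\: Y))| = #|blacks (C :&: (M :\: Y))|.
Proof.
move=> rM fY /subsetP YM fC rC.
have split_card (p : pred V) : #|[set x in C :&: M | p x]| =
    #|[set x in C :&: Y | p x]| + #|[set x in C :&: (M :\: Y) | p x]|.
  rewrite -(cardsID Y); congr (_ + _); apply: eq_card => x; rewrite !inE.
    have := YM x; case: (x \in Y) => [->|_] //; last by rewrite !andbF.
    by rewrite !andbT.
  by case: (x \in C) (x \in M) (x \in Y) => [] [] [].
have := card_whites_blacks (stableI rC rM).
have := card_whites_blacks (stableI fC fY).
rewrite /whites /blacks !(split_card white) !(split_card (fun x => ~~ white x)).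
by move=> ->; apply: addnI.
Qed.

End Matchings.

Arguments flip : simpl never.

(** * Two-edge cuts and the cycles that cross them *)

Section Cuts.

Variables (V : finType) (white : pred V).
Implicit Types (f r s : matching white) (Y M S : {set V}).

(** The points of [M :\: Y] are the legs by which [Y] is attached to the rest. By [balance] for the
    cycle of [x], a leg shares its cycle with a leg of the other color. *)
Lemma balance_transfer f r M Y x :
  stable r M -> stable f Y -> Y \subset M -> x \in M :\: Y ->
  exists2 y, y \in M :\: Y & (white y != white x) && conn (pair_of f r) x y.
Proof.
move=> rM fY YM xE; pose C := component (pair_of f r) x.
have fC : stable f C := @component_stable V white _ (pair_of f r) (Some tt) (x).
have rC : stable r C := @component_stable V white _ (pair_of f r) (None) (x).
have bal := balance rM fY YM fC rC.
have xC : x \in C :&: (M :\: Y) by rewrite inE mem_component.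
case wx : (white x).
  have : 0 < #|blacks white (C :&: (M :\: Y))|.
    by rewrite -bal; apply/card_gt0P; exists x; rewrite inE xC.
  case/card_gt0P => y; rewrite inE => /andP[/setIP[yC yE] wy]; exists y => //.
  by rewrite (negbTE wy) /=; rewrite inE in yC.
have : 0 < #|whites white (C :&: (M :\: Y))|.
  by rewrite bal; apply/card_gt0P; exists x; rewrite inE xC wx.
case/card_gt0P => y; rewrite inE => /andP[/setIP[yC yE] wy]; exists y => //.
by rewrite wy /=; rewrite inE in yC.
Qed.

Section Bubbles.

Variable I : finType.
Implicit Types P : I -> matching white.

(** The set [Y] is one side of the cut, a union of components of [P] whose only [r]-edges to the
    outside end at [v] or [w]. The degenerate case [r v = w] is allowed here and excluded where it
    matters. *)
Definition is_cut P r v w Y : Prop :=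
  [/\ forall i, stable (P i) Y, v \notin Y, w \notin Y &
      stable r (v |: (w |: Y))].

Section FlipCut.

Variables (P : I -> matching white) (r : matching white) (v w : V).
Hypothesis hvw : white v != white w.

(** The side that is cut off is the component of [r v] after the flip: if it contained [v], the flip
    would separate nothing. *)
Lemma flip_cut : conn P v w ->
  comps (extend P r) setT < comps (extend P (flip r v w)) setT ->
  exists Y, is_cut P r v w Y.
Proof.
move=> vw lt; pose F' := extend P (flip r v w); exists (component F' (r v)).
have st i : stable (P i) (component F' (r v)) :=
  @component_stable V white _ (F') (Some i) (r v).
have str : stable (flip r v w) (component F' (r v)) :=
  @component_stable V white _ (F') (None) (r v).
have nv : v \notin component F' (r v).
  rewrite inE /conn conn_sym -/(conn _ _ _); apply/negP => con.
  move: lt; rewrite ltnNge => /negP[]; apply: leq_ncc; first exact: conn_sym.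
  exact: sub_conn_unflip.
have rvY : r v \in component F' (r v) by apply: mem_component.
split=> //; first by rewrite -(conn_stable st vw).
move=> x; rewrite !in_setU1 => /or3P[/eqP->|/eqP->|xY].
- by rewrite rvY !orbT.
- by rewrite -(flip_nbrl r hvw) str ?orbT.
have := str _ xY; case: (flipP r hvw x) => [->|->|->|->|_ _ _ _ ->];
  rewrite ?matchK ?eqxx ?orbT // => vY.
  by rewrite rvY !orbT.
by rewrite vY in nv.
Qed.

(** The only legs of [Y] are [v] and [w], so a bicolored cycle through one of the cut edges also
    runs through the other, for each of the colors. *)
Lemma cut_transfer Y i : is_cut P r v w Y -> conn (pair_of (P i) r) v w.
Proof.
case=> sP nv nw sr.
have [||||y yE /andP[wy vy]] :=
  @balance_transfer (P i) r (v |: (w |: Y)) Y v => //.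
- by apply/subsetP => x xY; rewrite !inE xY !orbT.
- by rewrite !inE eqxx nv.
move: yE; rewrite !inE => /andP[/negbTE yY /or3P[/eqP yv|/eqP<-//|]];
  last by rewrite yY.
by rewrite yv eqxx in wy.
Qed.

Lemma cut_flip Y : r v != w -> is_cut P r v w Y -> conn P v w ->
  comps (extend P r) setT < comps (extend P (flip r v w)) setT.
Proof.
move=> rvw [sP nv nw sr] vw; apply: ltn_comps_flip; rewrite ?inE //.
  exact: sub_conn_extend.
have mem x : x \in Y -> (x != v) && (x != w).
  by move=> xY; apply/andP; split; apply/eqP => e; rewrite -?e xY in nv nw.
have rvY : r v \in Y.
  have := sr v; rewrite !inE eqxx => /(_ isT) /or3P[/eqP e|/eqP e|//].
    by have := white_match r v; rewrite e; case: (white v).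
  by rewrite e eqxx in rvw.
have rwY : r w \in Y.
  have := sr w; rewrite !inE eqxx orbT => /(_ isT) /or3P[/eqP e|/eqP e|//].
    by rewrite -e matchK eqxx in rvw.
  by have := white_match r w; rewrite e; case: (white w).
apply/negP => /(conn_extend_stable sP) e.
suff /e : stable (flip r v w) Y by rewrite (negbTE nv) rvY.
move=> x xY; have /andP[xv xw] := mem x xY.
case: (flipP r hvw x) => [e'|e'|//|//|_ _ xrv xrw].
- by rewrite e' eqxx in xv.
- by rewrite e' eqxx in xw.
have := sr x; rewrite !inE xY !orbT => /(_ isT) /or3P[/eqP e'|/eqP e'|//].
  by rewrite -e' matchK eqxx in xrv.
by rewrite -e' matchK eqxx in xrw.
Qed.

End FlipCut.
End Bubbles.
End Cuts.

(** * Contraction of a pair of vertices *)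

Section Contraction.

Variables (V : finType) (white : pred V).
Implicit Types (f r s : matching white) (Y M S : {set V}).

Lemma add_edges_connect (T : finType) es (e : rel T) ab :
  ab \in es -> connect (add_edges es e) ab.1 ab.2.
Proof.
elim: es => //= cd es IH; rewrite inE => /orP[/eqP->|/IH].
  exact: add_edge_connect.
exact: sub_add_edge.
Qed.

Lemma sub_add_edges (T : finType) es (e : rel T) :
  subrel (connect e) (connect (add_edges es e)).
Proof. by elim: es => //= ab es IH x y /IH; apply: sub_add_edge. Qed.

Section Contract.

Variables (v w : V).
Hypothesis hvw : white v != white w.

(** Flipping every matching at [v] and [w] turns the pair into a component of its own and splices
    the remaining edges at [v] and [w] together: the removal of the pair, with the vertex type
    unchanged. *)
Definition contract (I : finType) (F : I -> matching white) (i : I) :=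
  flip (F i) v w.

(** Up to connectivity, contraction is undone by tying [v] to its old neighbors. The list [es] is
    left free because fewer edges may suffice; this saving is what [contract_faces] needs. *)
Lemma conn_contract (I : finType) (F : I -> matching white) es i0 :
  F i0 v = w ->
  (forall i, connect (add_edges es (graph (contract F))) v (F i v)) ->
  (forall ab, ab \in es -> conn F ab.1 ab.2) ->
  connect (add_edges es (graph (contract F))) =2 conn F.
Proof.
move=> Fv esv esF; set H := add_edges es _.
have symH : connect_sym H by apply/sym_connect_sym/add_edges_sym/graph_sym.
have symF x y : conn F x y = conn F y x by rewrite /conn conn_sym.
have vwF : conn F v w by rewrite -Fv; apply: conn_step.
have stH i x : connect H x (contract F i x) by apply/sub_add_edges/conn_step.
have wvH : connect H w v by rewrite symH -[w](flipl (F i0) hvw); apply: stH.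
move=> x y; apply/idP/idP.
  apply: connect_sub => {x y}; elim: es esF {esv symH stH wvH} @H =>
    /= [_|ab es IH esF] x y.
    case/existsP=> i /eqP<-; rewrite /contract.
    case: (flipP (F i) hvw x) => [->//|->|->|->|_ _ _ _]; last exact: conn_step.
    - by rewrite -/(conn F _ _) symF.
    - by apply: conn_trans (_ : conn F v _); [rewrite symF; apply: conn_step |
        apply: conn_trans vwF _; apply: conn_step].
    - by apply: conn_trans (_ : conn F w _); [rewrite symF; apply: conn_step |
        rewrite symF in vwF; apply: conn_trans vwF _; apply: conn_step].
  have abF := esF ab (mem_head _ _).
  case/or3P=> [|/andP[/eqP-> /eqP->]//|/andP[/eqP-> /eqP->]];
    last by rewrite symF in abF.
  by apply: IH => cd cdes; apply: esF; rewrite inE cdes orbT.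
apply: connect_sub => {x y} x y /existsP[i /eqP<-].
have [->|xv] := eqVneq x v; first exact: esv.
have wFw : connect H w (F i w).
  apply: connect_trans (connect_trans wvH (esv i)) _.
  by rewrite -(flip_nbrl _ hvw); apply: stH.
have [->|xw] := eqVneq x w; first exact: wFw.
have [->|xrv] := eqVneq x (F i v); first by rewrite matchK symH; apply: esv.
have [->|xrw] := eqVneq x (F i w); first by rewrite matchK symH.
by rewrite -(flip_other hvw xv) //; apply: stH.
Qed.

Lemma extend_contract (I : finType) (F : I -> matching white) r : r v = w ->
  forall o, extend (contract F) r o =1 contract (extend F r) o.
Proof. by move=> rv [i|] x; [|rewrite -[RHS]/(flip r v w x) flip_id]. Qed.

Lemma sub_conn_contract (I : finType) (F : I -> matching white) i0 :
  F i0 v = w -> subrel (conn (contract F)) (conn F).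
Proof.
move=> Fv x y xy.
pose es := [seq (v, F i v) | i <- enum I].
rewrite -(@conn_contract I F es i0) //; first exact: sub_add_edges.
  move=> i; apply: (@add_edges_connect _ _ _ (v, F i v)).
  by apply: map_f; rewrite mem_enum.
by move=> _ /mapP[i _ ->] /=; apply: conn_step.
Qed.

(** After contraction [v] and [w] form a component, in which [w] is the only possible partner of
    [v]. *)
Lemma contract_fixed (I : finType) (F : I -> matching white) s :
  0 < #|I| -> (forall x, conn (contract F) x (s x)) -> s v = w.
Proof.
move=> /card_gt0P[i _] sF; have st j : stable (contract F j) [set v; w].
  by move=> x; rewrite !inE => /orP[/eqP->|/eqP->];
    rewrite /contract ?flipl ?flipr ?eqxx ?orbT.
have := conn_stable st (sF v); rewrite !inE eqxx => /esym/orP[/eqP e|/eqP//].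
by have := white_match s v; rewrite e; case: (white v).
Qed.

(** The same edges [es] undo the contraction of [F] and that of F + r, because [r v = w] requires no
    further one; so submodularity applies. *)
Lemma comps_contract_submod (I : finType) (F : I -> matching white) r i0 :
  F i0 v = w -> r v = w ->
  comps (extend (contract F) r) setT + comps F setT
    <= comps (contract F) setT + comps (extend F r) setT.
Proof.
move=> Fv rv; pose es := [seq (v, F i v) | i <- enum I].
have es_in i : (v, F i v) \in es by apply: map_f; rewrite mem_enum.
have symG := @graph_sym V white.
have symA (J : finType) (G : J -> matching white) :
  connect_sym (add_edges es (graph G)) by apply/sym_connect_sym/add_edges_sym.
have eqF : connect (add_edges es (graph (contract F))) =2 conn F.
  apply: (conn_contract Fv) => [i|_ /mapP[i _ ->]]; last exact: conn_step.
  exact: (@add_edges_connect _ _ _ (v, F i v)).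
have eqG : connect (add_edges es (graph (contract (extend F r)))) =2 conn
  (extend F r).
  apply: (@conn_contract _ _ _ (Some i0)) => // [[i|]|_ /mapP[i _ ->]].
  - exact: (@add_edges_connect _ _ _ (v, F i v)).
  - by rewrite /= rv -Fv; apply: (@add_edges_connect _ _ _ (v, F i0 v)).
  - exact: conn_extendl.
rewrite -(_ : comps (contract (extend F r)) setT = comps (extend (contract F)
  r) setT); last first.
  by apply: eq_comps_in => x _ y; apply: eq_conn => o z;
    rewrite extend_contract.
have -> : comps F setT = ncc (add_edges es (graph (contract F))) setT.
  by apply: eq_ncc => [||x _ y]; rewrite ?eqF //; apply: conn_sym.
have -> : comps (extend F r) setT = ncc (add_edges es (graph (contract (extend
  F r)))) setT.
  by apply: eq_ncc => [||x _ y]; rewrite ?eqG //; apply: conn_sym.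
apply: ncc_add_edges_submod => //.
by apply: sub_conn => i x; apply: (conn_step (contract (extend F r)) (Some i)).
Qed.

Lemma eq_cyclesl f f' r Y : f =1 f' -> cycles f r Y = cycles f' r Y.
Proof. by move=> ef; apply: eq_comps_in => x _ y; apply: eq_conn => -[[]|]. Qed.

(** The [r]-edge from [v] to [w] lies on one cycle, and the flip of [f] pinches it off as a cycle of
    length 2, unless it formed such a cycle already. *)
Lemma cycles_contract f r Y : r v = w -> stable f Y -> v \in Y ->
  cycles (flip f v w) r Y = cycles f r Y + (f v != w).
Proof.
move=> rv fY vY; case: eqP => [fv|/eqP fv]; rewrite ?addn0 ?addn1.
  exact/eq_cyclesl/flip_id.
apply/eqP; rewrite eqn_leq ![cycles _ r Y]cyclesC leq_comps_unflip //=.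
apply: ltn_cycles_flip; rewrite ?fY // -rv.
exact: conn_extendl (fun=> r) f tt v.
Qed.

Definition bicycles (P : 'I_3 -> matching white) r Y :=
  \sum_(i < 3) cycles (P i) r Y.

Lemma bicycles_contract (P : 'I_3 -> matching white) r : r v = w ->
  bicycles (contract P) r setT = bicycles P r setT + \sum_(i < 3) (P i v != w).
Proof.
move=> rv; rewrite /bicycles -big_split; apply: eq_bigr => i _.
by rewrite cycles_contract // => x; rewrite !inE.
Qed.

End Contract.
End Contraction.

(** * Removing an edge and improving a matching *)

Section Optimality.

Variables (V : finType) (white : pred V).
Implicit Types (f r s : matching white) (Y M S : {set V}).
Implicit Types P : 'I_3 -> matching white.

Definition preserves P s := forall x, conn P x (s x).

(* The defect #|whites| - cycles s r is the least number of flips turning r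
   into s; each of them adds at most one component, so the last inequality
   says that s is reached from r by flips that all disconnect the graph. *)
Definition good P r := exists2 s, preserves P s &
  bicycles P r setT + 3 * comps P setT
    < bicycles P s setT + 3 * comps (extend P r) setT \/
  bicycles P r setT + 3 * comps P setT
    = bicycles P s setT + 3 * comps (extend P r) setT /\
  #|whites white setT| + comps (extend P r) setT
    <= comps P setT + cycles s r setT.

(** The hypothesis means psi r < psi r'. Here and below, the negative terms of psi are moved across
    so as to stay in the natural numbers. *)
Lemma good_lt P r r' :
  bicycles P r setT + 3 * comps (extend P r') setT
    < bicycles P r' setT + 3 * comps (extend P r) setT ->
  good P r' -> good P r.
Proof. by move=> lt [s sP [h|[h _]]]; exists s => //; left; lia. Qed.

(** A disconnecting flip can be prepended to the flips that lead to [s]: it adds at least one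
    component and at most one cycle of [s] and [r], so the last inequality of [good] passes to
    [r]. *)
Lemma good_flip P r v w : white v != white w ->
  bicycles P r setT + 3 * comps (extend P (flip r v w)) setT
    <= bicycles P (flip r v w) setT + 3 * comps (extend P r) setT ->
  comps (extend P r) setT < comps (extend P (flip r v w)) setT ->
  good P (flip r v w) -> good P r.
Proof.
move=> hvw le lt [s sP h]; exists s => //.
have lecyc : cycles s (flip r v w) setT <= (cycles s r setT).+1.
  exact: leq_comps_unflip.
by case: h => [h|[h h']]; lia.
Qed.

(** Both [r] and [s] contain the pair, so contraction changes their bicycle counts equally;
    submodularity moves the component counts in the right direction, and in case of equality their
    differences agree. *)
Lemma good_contract P r v w i : white v != white w -> r v = w -> P i v = w ->
  good (contract v w P) r -> good P r.
Proof.
move=> hvw rv Pv [s sP h]; exists s.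
  by move=> x; apply: (sub_conn_contract hvw Pv).
have sv : s v = w by apply: (contract_fixed hvw _ sP); rewrite card_ord.
have := comps_contract_submod hvw Pv rv.
rewrite !bicycles_contract // in h.
by case: h => [h|[h h']]; lia.
Qed.

(** For each color the change is at least +1 if [v] and [w] share a cycle and at least -1
    otherwise. *)
Lemma bicycles_flip P r v w : white v != white w -> r v != w ->
  bicycles P r setT + (\sum_(i < 3) conn (pair_of (P i) r) v w).*2
    <= bicycles P (flip r v w) setT + 3.
Proof.
move=> hvw rvw; rewrite /bicycles -muln2 big_distrl /= -big_split /=.
rewrite -[X in _ <= _ + X](card_ord 3) -sum1_card -big_split /=;
  apply: leq_sum => i _.
case: (boolP (conn _ _ _)) => con; last first.
  by rewrite mul0n addn0 addn1; apply: leq_comps_flip.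
by rewrite mul1n addn2 addn1 ltnS; apply: ltn_cycles_flip; rewrite ?inE.
Qed.

Lemma leq_comps_flip_conn P r v w : white v != white w -> conn P v w ->
  comps (extend P r) setT <= comps (extend P (flip r v w)) setT.
Proof.
move=> hvw vw; apply: leq_ncc; first exact: conn_sym.
by apply: sub_conn_flip => //; apply: sub_conn_extend.
Qed.

Lemma cut_bicycles_flip P r v w Y : white v != white w -> r v != w ->
  is_cut P r v w Y ->
  bicycles P r setT + 3 <= bicycles P (flip r v w) setT.
Proof.
move=> hvw rvw cut; have := bicycles_flip P hvw rvw.
under eq_bigr do rewrite (cut_transfer _ cut).
by rewrite sum1_card card_ord; lia.
Qed.

Lemma raise_bicycles_flip P r v w : white v != white w -> r v != w ->
  conn P v w ->
  comps (extend P r) setT < comps (extend P (flip r v w)) setT ->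
  bicycles P r setT + 3 <= bicycles P (flip r v w) setT.
Proof. by move=> hvw rvw vw /(flip_cut hvw vw)[Y]; apply: cut_bicycles_flip.
Qed.

End Optimality.

(** * Faces of planar components *)

Section Genus.

Variables (V : finType) (white : pred V).
Implicit Types (f r s : matching white) (Y M S : {set V}).
Implicit Types P : 'I_3 -> matching white.

Definition faces P Y := \sum_(i < 3) cycles (P i) (P (ordS i)) Y.

Lemma ordS3 (i : 'I_3) : ordS (ordS (ordS i)) = i.
Proof. by apply: val_inj; case: i => [[|[|[|]]]]. Qed.

Lemma ordS3E (i j : 'I_3) : [|| j == i, j == ordS i | j == ordS (ordS i)].
Proof. by case: i j => [[|[|[|//]]] ?] [[|[|[|//]]] ?]. Qed.

Lemma sum_ordS3 (g : 'I_3 -> nat) i :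
  \sum_l g l = g i + g (ordS i) + g (ordS (ordS i)).
Proof.
have /and3P[n1 n2 n3] : [&& ordS i != i, ordS (ordS i) != i
                          & ordS (ordS i) != ordS i].
  by case: i => [[|[|[|//]]] ?].
rewrite (bigD1 i) //= (bigD1 (ordS i)) //= (bigD1 (ordS (ordS i))) ?n2 //=.
rewrite big_pred0 ?addn0 ?addnA // => l.
by case/or3P: (ordS3E i l) => /eqP->; rewrite eqxx ?andbF.
Qed.

Lemma facesE P Y i (j := ordS i) (k := ordS j) :
  faces P Y = cycles (P i) (P j) Y + cycles (P j) (P k) Y + cycles (P k) (P i)
    Y.
Proof. by rewrite /faces (sum_ordS3 _ i) ordS3. Qed.

(** Contraction does not increase the genus: for p white vertices, k components and f faces, Euler's
    formula gives f - p = 2k - 2g with g the total genus, and p does not change. *)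
Lemma contract_faces P S v w i : white v != white w ->
  (forall l, stable (P l) S) -> v \in S -> P i v = w ->
  faces P S + 2 * comps (contract v w P) S
    <= faces (contract v w P) S + 2 * comps P S.
Proof.
move=> hvw sS vS Pv; set Q := contract v w P.
set j := ordS i; set k := ordS j.
rewrite !(facesE _ _ i) -/j -/k.
have Qv l : Q l v = w by rewrite /Q /contract flipl.
have Qe l : P l v = w -> Q l =1 P l by move=> *; apply: flip_id.
have sQ l : stable (Q l) S.
  by apply: flip_stable => //; rewrite -Pv stable_mem.
have cQ : conn Q v w by rewrite -(Qv i); apply: conn_step.
have cyc1 (l l' : 'I_3) : P l v = w ->
  cycles (Q l) (Q l') S = cycles (P l) (P l') S + (P l' v != w).
  move=> lv; rewrite (eq_cyclesl _ _ (Qe _ lv)) [LHS]cyclesC [in RHS]cyclesC.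
  exact: cycles_contract.
(* The faces of colors [j] and [k] change in two steps: flipping [P j] may gain or lose one, and
   flipping [P k] afterwards only pinches off the pair. *)
have cyc2 : cycles (Q j) (Q k) S = cycles (P k) (Q j) S + (P k v != w).
  by rewrite cyclesC; apply: cycles_contract.
have compsE es : (forall l, connect (add_edges es (graph Q)) v (P l v)) ->
  (forall ab, ab \in es -> conn P ab.1 ab.2) ->
  comps Q S <= comps P S + size es.
  move=> h1 h2; apply: leq_trans (leq_ncc_add_edges es S (@graph_sym _ _ _ Q))
    _.
  rewrite leq_add2r; apply: eq_leq; apply: eq_ncc => [||x _ y].
  - exact/sym_connect_sym/add_edges_sym/graph_sym.
  - exact: conn_sym.
  - by rewrite (conn_contract hvw Pv h1 h2).
have conP l : conn P v (P l v) by apply: conn_step.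
(* The booleans tell whether the edge of color [j], respectively [k], at [v] has to be restored; a
   color parallel to [i] costs nothing. *)
have compsP (a b : bool) : (P j v != w -> a) -> (P k v != w -> b) ->
  comps Q S <= comps P S + a + b.
  move=> ja kb; pose es := nseq a (v, P j v) ++ nseq b (v, P k v).
  have := compsE es; rewrite size_cat !size_nseq addnA; apply; last first.
    move=> ab; rewrite mem_cat !mem_nseq.
    by case/orP => /andP[_ /eqP->]; apply: conP.
  move=> l; have [lv|/eqP lv] := eqVneq (P l v) w.
    by rewrite lv; apply: sub_add_edges; apply: cQ.
  apply: (@add_edges_connect _ _ _ (v, P l v)); rewrite mem_cat !mem_nseq.
  case/or3P: (ordS3E i l) => /eqP el; rewrite el ?Pv // in lv *.
    by rewrite ja ?eqxx //; apply/eqP.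
  by rewrite [b]kb ?eqxx ?orbT //; apply/eqP.
have cij := cyc1 i j Pv; have cik := cyc1 i k Pv.
have [jw|jw] := eqVneq (P j v) w.
  have := compsP false (P k v != w); rewrite jw eqxx /= => /(_ id id).
  rewrite jw eqxx in cij; have cjk := cyc1 j k jw.
  by rewrite [cycles (P k) _ S]cyclesC [cycles (Q k) _ S]cyclesC cij cik cjk;
    case: (_ != _) => /=; lia.
have [kw|kw] := eqVneq (P k v) w.
  have := compsP true false; rewrite kw eqxx /= => /(_ (fun=> isT) id).
  rewrite kw eqxx in cik; have ckj := cyc1 k j kw; rewrite jw in cij ckj.
  rewrite [cycles (P k) _ S]cyclesC [cycles (Q k) _ S]cyclesC cij cik [cycles
    (Q j) _ _]cyclesC ckj.
  by rewrite [cycles (P k) _ _]cyclesC; lia.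
rewrite jw kw in cij cik cyc2.
rewrite [cycles (P k) _ S]cyclesC [cycles (Q k) _ S]cyclesC cij cik cyc2
  [cycles (P j) _ _]cyclesC.
(* No other edge is parallel to [i]. If [v] and [w] share the third face, there are at least 4 more
   faces and at most 2 more components. Otherwise a face may be lost, leaving a gain of only 2, and
   at most one more component may arise. *)
have [con|ncon] := boolP (conn (pair_of (P k) (P j)) v w).
  have lt : cycles (P k) (P j) S < cycles (P k) (Q j) S.
    by apply: ltn_cycles_flip => //; apply: sS.
  by have := compsP true true (fun=> isT) (fun=> isT); lia.
have le : cycles (P k) (P j) S <= (cycles (P k) (Q j) S).+1.
  exact: leq_comps_flip.
suff : comps Q S <= comps P S + 1 by lia.
(* The walk from P j v to P k v around the face through v avoids w. *)
pose Y := component Q (P j v).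
have sY l : stable (Q l) Y by apply: component_stable.
have vY : v \notin Y.
  rewrite inE /conn conn_sym; apply/negP => con.
  have st l : stable (Q l) [set v; w].
    move=> x; rewrite !inE => /orP[/eqP->|/eqP->].
      by rewrite Qv eqxx orbT.
    by rewrite -(Qv l) matchK eqxx.
  have := conn_stable st con; rewrite !inE eqxx => /esym/orP[/eqP e|/eqP e].
    by have := white_match (P j) v; rewrite e; case: (white v).
  by rewrite e eqxx in jw.
have wY : w \notin Y by rewrite -(conn_stable sY cQ).
apply: (compsE [:: (v, P j v)]) => [l|ab]; last by rewrite inE => /eqP->;
  apply: conP.
case/or3P: (ordS3E i l) => /eqP->; first by rewrite Pv; apply: sub_add_edge;
  apply: cQ.
  exact: (add_edge_connect (v, P j v)).
apply: connect_trans (add_edge_connect (v, P j v) _) _.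
apply: sub_add_edge; rewrite -/k -/(conn _ _ _).
have [|kY] := boolP (P k v \in Y); first by rewrite inE.
have jvY : P j v \in Y by apply: mem_component.
case/negP: ncon.
have [|||| y] := @balance_transfer _ white (P k) (P j) (v |: (w |: Y)) Y v.
- move=> x; rewrite !in_setU1 => /or3P[/eqP->|/eqP->|xY].
  + by rewrite jvY !orbT.
  + by rewrite -(flip_nbrl _ hvw) sY ?orbT.
  + have := sY j _ xY; rewrite /Q /contract.
    case: (flipP (P j) hvw x) => [e|e|->|->|_ _ _ _ ->];
      rewrite ?matchK ?eqxx ?orbT // ?(negbTE wY) ?(negbTE vY) //.
- move=> x xY; have := sY k _ xY; rewrite /Q /contract.
  case: (flipP (P k) hvw x) => [e|e|e|e|//];
    rewrite ?(negbTE wY) ?(negbTE vY) ?(negbTE kY) //.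
  by rewrite -e xY in kY.
- by apply/subsetP => x xY; rewrite !in_setU1 xY !orbT.
- by rewrite in_setD !in_setU1 eqxx vY.
rewrite in_setD !in_setU1 => /andP[/negbTE->].
by case/or3P => [/eqP->|/eqP->|//]; rewrite ?eqxx // => /andP[].
Qed.

End Genus.

Section SmallFace.

Variables (V : finType) (white : pred V).
Implicit Types (f r s : matching white) (Y M S : {set V}).
Implicit Types P : 'I_3 -> matching white.

Lemma comps_setU (I : finType) (F : I -> matching white) S S' :
  (forall i, stable (F i) S) -> [disjoint S & S'] ->
  comps F (S :|: S') = comps F S + comps F S'.
Proof.
move=> st; apply: ncc_setU; first exact: conn_sym.
by move=> x y xS /existsP[i /eqP<-]; apply: st.
Qed.

Lemma faces_setU P S S' :
  (forall i, stable (P i) S) -> [disjoint S & S'] ->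
  faces P (S :|: S') = faces P S + faces P S'.
Proof.
move=> st dis; rewrite -big_split; apply: eq_bigr => i _.
by apply: comps_setU dis => -[[]|]; apply: st.
Qed.

Lemma card_whites_setU S S' : [disjoint S & S'] ->
  #|whites white (S :|: S')| = #|whites white S| + #|whites white S'|.
Proof.
move=> dis; rewrite -cardsUI [X in _ = _ + X](_ : _ = 0) ?addn0.
  by apply: eq_card => x; rewrite !inE andb_orl.
apply/eqP; rewrite cards_eq0 -subset0; apply/subsetP => x; rewrite !inE.
by case/andP => /andP[xS _] /andP[]; rewrite (disjointFr dis xS).
Qed.

Section Dipole.

Variables (P : 'I_3 -> matching white) (S : {set V}) (v w : V) (i : 'I_3).
Hypotheses (hvw : white v != white w) (sS : forall l, stable (P l) S).
Hypotheses (vS : v \in S) (Pv : P i v = w).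

Let Q := contract v w P.
Let T := [set v; w].

Lemma dipole_sub : T \subset S.
Proof. by apply/subsetP => x; rewrite !inE -Pv => /orP[]/eqP->//; apply: sS.
Qed.

Lemma contract_dipole l : stable (Q l) T.
Proof.
by move=> x; rewrite !inE /Q /contract => /orP[]/eqP->;
  rewrite ?flipl ?flipr ?eqxx ?orbT.
Qed.

Lemma contract_stable l : stable (Q l) S.
Proof. by apply: flip_stable => //; rewrite -Pv stable_mem. Qed.

Lemma contract_stableD l : stable (Q l) (S :\: T).
Proof. by apply: stableD; [apply: contract_stable | apply: contract_dipole].
Qed.

Lemma dipole_disjoint : [disjoint T & S :\: T].
Proof. by rewrite -setI_eq0 setIDA setDIl setDv set0I. Qed.

Lemma dipole_setU : T :|: (S :\: T) = S.
Proof. by rewrite setDE setUIr setUCr setIT; apply/setUidPr/dipole_sub. Qed.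

Lemma comps_dipole (J : finType) (F : J -> matching white) (l : J) :
  F l v = w -> comps F T = 1.
Proof.
move=> Fl; apply: ncc_connected; first exact: conn_sym.
  by exists v; rewrite !inE eqxx.
have vw : conn F v w by rewrite -Fl; apply: conn_step.
have wv : conn F w v by rewrite /conn conn_sym.
by move=> x y; rewrite !inE => /orP[]/eqP-> /orP[]/eqP-> //; apply: conn_refl.
Qed.

Lemma comps_contractD : comps Q S = (comps Q (S :\: T)).+1.
Proof.
rewrite -{1}dipole_setU (comps_setU _ dipole_disjoint);
  last exact: contract_dipole.
by rewrite (comps_dipole (l := i)) // /Q /contract flipl.
Qed.

Lemma faces_contractD : faces Q S = faces Q (S :\: T) + 3.
Proof.
rewrite -{1}dipole_setU (faces_setU _ dipole_disjoint);
  last exact: contract_dipole.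
rewrite addnC; congr (_ + _); rewrite -[RHS](card_ord 3) -sum1_card.
apply: eq_bigr => l _; apply: (comps_dipole (l := None)).
by rewrite /Q /contract /= -[LHS]/(flip _ v w v) flipl.
Qed.

Lemma card_whitesD : #|whites white S| = (#|whites white (S :\: T)|).+1.
Proof.
rewrite -{1}dipole_setU (card_whites_setU dipole_disjoint) -add1n;
  congr (_ + _).
apply/eqP/cards1P; exists (if white v then v else w).
apply/setP => x; rewrite !inE; case wv : (white v) hvw.
  have [->|_] := eqVneq x v; first by rewrite wv.
  by have [->|_] := eqVneq x w; case: (white w).
move=> ww; have [->|_] := eqVneq x v.
  by rewrite wv; apply/esym/eqP => e; rewrite -e wv in ww.
by have [->|_] := eqVneq x w; case: (white w) ww.
Qed.

Lemma card_contractD : #|S :\: T| < #|S|.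
Proof.
apply/proper_card/properP; split; first exact: subsetDl.
by exists v => //; rewrite !inE eqxx.
Qed.

End Dipole.

Lemma white_matchN f x : white x != white (f x).
Proof. by rewrite white_match; case: (white x). Qed.

(** The genus never grows under contraction, and repeated contraction ends with the empty set. *)
Lemma genus_ge0 P S : (forall i, stable (P i) S) ->
  faces P S <= #|whites white S| + 2 * comps P S.
Proof.
elim: {S}_.+1 {-2}S (ltnSn #|S|) P => // n IH S ltS P sS.
have [->|[v vS]] := set_0Vmem S.
  by rewrite /faces big1 // => i _; apply: ncc_set0.
have hvw := white_matchN (P ord0) v; set w := P ord0 v in hvw.
have := contract_faces hvw sS vS (erefl w).
have /IH : #|S :\: [set v; w]| < n.
  by rewrite ltnS in ltS; apply: leq_trans ltS; apply: card_contractD.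
move=> /(_ (contract v w P) (contract_stableD hvw sS (erefl w))).
rewrite (comps_contractD hvw sS vS (erefl w)).
rewrite (faces_contractD hvw sS vS (erefl w)) (card_whitesD hvw sS vS (erefl
  w)).
by lia.
Qed.

(** A set with p white vertices has 2p vertices and 3p edges, so this is Euler's formula summed over
    the components: the total genus is 0, hence each genus is. *)
Definition planar_on P S := faces P S = #|whites white S| + 2 * comps P S.

(** The genus after contraction is squeezed between 0 and the genus before. *)
Lemma planar_contract P S v w i : white v != white w ->
  (forall l, stable (P l) S) -> v \in S -> P i v = w -> planar_on P S ->
  planar_on (contract v w P) (S :\: [set v; w]).
Proof.
rewrite /planar_on => hvw sS vS Pv pl; have := contract_faces hvw sS vS Pv.
have := genus_ge0 (contract_stableD hvw sS Pv).
rewrite (comps_contractD hvw sS vS Pv).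
rewrite (faces_contractD hvw sS vS Pv) pl (card_whitesD hvw sS vS Pv).
by lia.
Qed.

(** Genus is additive over stable disjoint parts and nonnegative on each. *)
Lemma planarD P S A : (forall l, stable (P l) S) ->
  (forall l, stable (P l) A) ->
  A \subset S -> planar_on P S -> planar_on P (S :\: A).
Proof.
rewrite /planar_on => sS sA AS pl.
have dis : [disjoint A & S :\: A]
  by rewrite -setI_eq0 setIDA setDIl setDv set0I.
have eS : A :|: (S :\: A) = S by rewrite setDE setUIr setUCr setIT;
  apply/setUidPr.
have := genus_ge0 sA; have := genus_ge0 (fun l => stableD (sS l) (sA l)).
move: pl; rewrite -{1 2 3}eS (comps_setU sA dis) (faces_setU sA dis).
rewrite (card_whites_setU dis); lia.
Qed.

(** The hypothesis excludes cycles of length 4 and also of length 2, as those return to [v] too; so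
    every cycle contains three distinct white vertices. *)
Lemma leq_cycles_whites f r S : stable f S -> stable r S ->
  {in S, forall v, white v -> f (r (f (r v))) != v} ->
  3 * cycles f r S <= #|whites white S|.
Proof.
move=> fS rS nofix; set e := graph (pair_of f r).
have sym : connect_sym e by apply: conn_sym.
pose rt := root e.
rewrite /cycles /comps /ncc -/e mulnC -sum_nat_const.
rewrite -[X in _ <= X]sum1_card [X in _ <= X](partition_big rt (mem (rt @: S)))
  /=; last first.
  by move=> x /setIdP[xS _]; apply: imset_f.
apply: leq_sum => z /imsetP[y yS ->]; rewrite sum1_card.
have [v [vS wv yv]] : exists v, [/\ v \in S, white v & conn (pair_of f r) y v].
  case wy : (white y); first by exists y; split => //; apply: conn_refl.
  by exists (r y); split; rewrite ?rS ?white_match ?wy //; apply: conn_extendr.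
pose g x := f (r x).
have gc x : conn (pair_of f r) x (g x).
  by apply: conn_trans (conn_extendr _ _ _) (conn_extendl (fun=> f) _ tt _).
have wg x : white (g x) = white x by rewrite !white_match negbK.
have gS x : x \in S -> g x \in S by move=> xS; apply/fS/rS.
have un : uniq [:: v; g v; g (g v)].
  have n1 x : x \in S -> white x -> x != g x.
    move=> xS wx; apply/eqP => e1; have := nofix x xS wx.
    by rewrite -/(g x) -/(g (g x)) -e1 -e1 eqxx.
  have n2 : v != g (g v) by rewrite eq_sym; apply: nofix.
  by rewrite /= !inE negb_or n1 // n2 n1 ?gS ?wg.
rewrite -[3]/(size [:: v; g v; g (g v)]) -(card_uniqP un).
apply/subset_leq_card/subsetP => x xs.
have [xS wx cx] : [/\ x \in S, white x & conn (pair_of f r) v x].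
  move: xs; rewrite !inE => /or3P[]/eqP->; split; rewrite ?wg ?gS //.
  - exact: conn_refl.
  - exact: conn_trans (gc v) (gc _).
rewrite unfold_in inE xS wx /=; apply/eqP/(rootP sym).
by rewrite sym; apply: connect_trans yv cx.
Qed.

(** Every white vertex lies on three faces. If each face had at least three white vertices, there
    would be at most as many faces as white vertices, against Euler's formula. Faces of length 2
    satisfy the conclusion as well. *)
Lemma small_face P S v : (forall i, stable (P i) S) -> planar_on P S ->
  v \in S -> exists i j x,
    [/\ i != j, x \in S, white x & P j (P i (P j (P i x))) = x].
Proof.
move=> sS pl vS.
have k_gt0 : 0 < comps P S by apply/card_gt0P; exists (root (graph P) v);
  apply: imset_f.
have [/existsP[i /existsP[x /and3P[xS wx /eqP e]]]|] :=
  boolP [exists i, [exists x, [&& x \in S, white x &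
    P i (P (ordS i) (P i (P (ordS i) x))) == x]]].
  exists (ordS i), i, x; split => //.
  by case: i {e} => [[|[|[|//]]] ?].
move=> /existsPn no.
have : 3 * faces P S <= \sum_(i < 3) #|whites white S|.
  rewrite big_distrr; apply: leq_sum => i _;
    apply: leq_cycles_whites => // x xS wx.
  by have /existsPn/(_ x) := no i; rewrite xS wx.
rewrite sum_nat_const card_ord pl; lia.
Qed.

End SmallFace.

(** * Quadrangular faces *)

Section Distance.

Variables (V : finType) (white : pred V).
Implicit Types (f r s : matching white) (Y M S : {set V}).
Implicit Types P : 'I_3 -> matching white.

(** A flip that creates an edge of [s] only destroys edges of [r] that are not in [s]. *)
Lemma flip_agree r s x y : r x != s x -> r y = s y -> flip r x (s x) y = s y.
Proof.
move=> rsx ry; rewrite flip_other ?white_matchN ?ry //;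
  apply: contraNneq rsx => e; rewrite e in ry.
- by rewrite ry.
- by rewrite -[X in _ == X](matchK r) ry matchK.
- by rewrite -[r x](matchK s) -ry matchK.
- by move: ry; rewrite matchK => /match_inj ex; rewrite {1}ex matchK.
Qed.

Lemma card_flip_disagree r s x : r x != s x ->
  #|[set y | flip r x (s x) y != s y]| < #|[set y | r y != s y]|.
Proof.
move=> rsx; apply/proper_card/properP; split.
  by apply/subsetP => y; rewrite !inE; apply: contra => /eqP ry;
    rewrite flip_agree.
by exists x; rewrite !inE ?rsx // flipl ?white_matchN // eqxx.
Qed.

Lemma leq_cycles_card f r : cycles f r setT <= #|whites white setT|.
Proof.
rewrite /cycles /comps /ncc;
  apply: leq_trans (leq_imset_card (root (graph (pair_of f r))) _).
apply/subset_leq_card/subsetP => _ /imsetP[y _ ->]; apply/imsetP.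
case wy : (white y); first by exists y; rewrite ?inE.
exists (r y); first by rewrite !inE white_match wy.
by apply/rootP; [apply: conn_sym | apply: conn_extendr].
Qed.

(** Flips towards [s] each add at least one cycle of [s] and [r] but at most one component. This is
    the converse of the last inequality in [good], which is thus an equality. *)
Lemma leq_preserves_cycles P r s : preserves P s ->
  comps P setT + cycles s r setT
    <= #|whites white setT| + comps (extend P r) setT.
Proof.
move=> sP; elim: {r}_.+1 {-2}r (ltnSn #|[set x | r x != s x]|) => // n IH r ltn.
have [agree|[x]] := set_0Vmem [set x | r x != s x].
  have rs x : r x = s x.
    by apply/eqP; have := in_set0 x; rewrite -agree inE => /negbFE.
  have le : comps P setT <= comps (extend P r) setT.
    apply: leq_ncc; first exact: conn_sym.
    apply: sub_conn => -[l|] x; first exact: conn_step.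
    by rewrite [extend _ _ _]/= rs; apply: sP.
  by have := leq_cycles_card s r; lia.
rewrite inE => rsx; pose r' := flip r x (s x).
have hx := white_matchN s x.
have := IH r' (leq_trans (card_flip_disagree rsx) ltn).
have : cycles s r setT < cycles s r' setT.
  by apply: ltn_cycles_flip; rewrite ?inE //;
    apply: conn_extendl (fun=> s) _ tt _.
have := leq_comps_unflip r hx P setT.
by rewrite -/r'; lia.
Qed.

(** In case of equality no flip towards [s] is wasted, and since the flips may start at any [u], the
    flip at [u] adds a component. *)
Lemma tight_cut P r s u : preserves P s ->
  #|whites white setT| + comps (extend P r) setT
    <= comps P setT + cycles s r setT ->
  r u != s u -> exists Y, is_cut P r u (s u) Y.
Proof.
move=> sP tight rsu; have hu := white_matchN s u; apply: flip_cut => //.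
have := leq_preserves_cycles (flip r u (s u)) sP.
have : cycles s r setT < cycles s (flip r u (s u)) setT.
  by apply: ltn_cycles_flip; rewrite ?inE //;
    apply: conn_extendl (fun=> s) _ tt _.
by lia.
Qed.

(** The set [W] contains both or neither of [r v] and [r w], which the flip matches. If it contains
    both, undoing the flip attaches [v] and [w] to it. *)
Lemma unflip_stable r v w W : white v != white w ->
  stable (flip r v w) W -> v \notin W -> w \notin W ->
  stable r W \/ stable r (v |: (w |: W)).
Proof.
move=> hvw st vW wW; have [rvW|rvW] := boolP (r v \in W); [right|left].
  have rwW : r w \in W by rewrite -(flip_nbrl r hvw); apply: st.
  move=> x; rewrite !in_setU1 => /or3P[/eqP->|/eqP->|xW].
  - by rewrite rvW !orbT.
  - by rewrite rwW !orbT.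
  - have := st x xW; case: (flipP r hvw x) => [e|e|->|->|_ _ _ _ ->];
      rewrite ?(negbTE wW) ?(negbTE vW) ?matchK ?eqxx ?orbT // => ->;
      rewrite !orbT.
have rwW : r w \notin W.
  by apply: contra rvW => rwW; rewrite -(flip_nbrr r hvw); apply: st.
move=> x xW; rewrite -(@flip_other _ _ r v w) // ?st //;
  apply: contraTneq xW => ->; assumption.
Qed.

End Distance.

(** By [bicycles_flip], a flip with one shared cycle loses at most one cycle, and a flip with two
    shared cycles gains at least one. *)
Lemma leq_two_flips a b c x y : a + x.*2 <= b + 3 -> b + y.*2 <= c + 3 ->
  1 <= x -> 2 <= y -> a <= c.
Proof. lia. Qed.

(* v1, w1, v2, w2 are the corners of a quadrangular face with colors i and j;
   [share] and [nocut] hold when no single flip in its component improves r. *)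
Section Quadrangle.

Variables (V : finType) (white : pred V).
Variables (P : 'I_3 -> matching white) (r : matching white).
Variables (v1 : V) (i j c : 'I_3).

Let w1 := P i v1.
Let v2 := P j w1.
Let w2 := P i v2.
Let A := component P v1.

Hypotheses (ij : i != j) (ci : c != i) (cj : c != j) (wv1 : white v1).
Hypotheses (v12 : v1 != v2) (face : P j w2 = v1).
Hypotheses (n11 : r v1 != w1) (n22 : r v2 != w2) (n12 : r v1 != w2)
  (n21 : r v2 != w1).

Hypothesis share : forall u u' k l, u \in A -> u' \in A ->
  white u != white u' -> k != l -> conn (pair_of (P k) r) u u' ->
  conn (pair_of (P l) r) u u' -> r u = u'.
Hypothesis nocut : forall u u', u \in A -> u' \in A ->
  white u != white u' -> r u != u' ->
  comps (extend P (flip r u u')) setT <= comps (extend P r) setT.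

Definition quad_flip1 := flip r v1 w1.
Definition quad_flip := flip quad_flip1 v2 w2.
Let r1 := quad_flip1.
Let r2 := quad_flip.

Let A_stable l : stable (P l) A. Proof. exact: component_stable. Qed.
Let v1A : v1 \in A. Proof. exact: mem_component. Qed.
Let w1A : w1 \in A. Proof. exact: A_stable. Qed.
Let v2A : v2 \in A. Proof. exact: A_stable. Qed.
Let w2A : w2 \in A. Proof. exact: A_stable. Qed.
Let ww1 : white w1 = false. Proof. by rewrite white_match wv1. Qed.
Let wv2 : white v2. Proof. by rewrite white_match ww1. Qed.
Let ww2 : white w2 = false. Proof. by rewrite white_match wv2. Qed.
Let h11 : white v1 != white w1. Proof. by rewrite wv1 ww1. Qed.
Let h22 : white v2 != white w2. Proof. by rewrite wv2 ww2. Qed.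
Let w12 : w1 != w2. Proof. by rewrite (inj_eq (@match_inj _ _ (P i))). Qed.

Let Pl k u : conn (pair_of (P k) r) u (P k u).
Proof. exact: conn_extendl (fun=> P k) r tt u. Qed.

Let Pw2 : conn (pair_of (P j) r) v1 w2.
Proof. by rewrite /conn conn_sym -face; apply: Pl. Qed.

Let Pw1 : conn (pair_of (P j) r) v2 w1.
Proof. by rewrite /conn conn_sym; apply: Pl. Qed.

Let nshare u u' k l : u \in A -> u' \in A ->
  white u != white u' -> k != l -> r u != u' ->
  conn (pair_of (P k) r) u u' -> ~~ conn (pair_of (P l) r) u u'.
Proof.
by move=> uA u'A h kl n ck; apply: contra n => cl;
  apply/eqP/(share uA u'A h kl).
Qed.

(** Neighboring corners share the cycle given by the color of their edge, so [share] keeps them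
    apart in the remaining colors that are used below. *)
Let j11 : ~~ conn (pair_of (P j) r) v1 w1. Proof.
  exact: nshare ij n11 (Pl _ _). Qed.
Let j22 : ~~ conn (pair_of (P j) r) v2 w2. Proof.
  exact: nshare ij n22 (Pl _ _). Qed.
Let c11 : ~~ conn (pair_of (P c) r) v1 w1.
Proof. by apply: nshare (Pl i _) => //; rewrite eq_sym. Qed.
Let c22 : ~~ conn (pair_of (P c) r) v2 w2.
Proof. by apply: nshare (Pl i _) => //; rewrite eq_sym. Qed.
Let c12 : ~~ conn (pair_of (P c) r) v1 w2.
Proof. by apply: nshare Pw2 => //; rewrite ?wv1 ?ww2 // eq_sym. Qed.
Let c21 : ~~ conn (pair_of (P c) r) v2 w1.
Proof. by apply: nshare Pw1 => //; rewrite ?wv2 ?ww1 // eq_sym. Qed.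

Let conA x : x \in A -> conn P v1 x. Proof. by rewrite inE. Qed.

Let outside Y u : (forall l, stable (P l) Y) -> u \in A -> u \notin Y ->
  forall x, x \in A -> x \notin Y.
Proof.
by move=> sY uA uY x xA;
  rewrite -(conn_stable sY (conA xA)) (conn_stable sY (conA uA)).
Qed.

Let symc k u u' : conn (pair_of (P k) r) u u' = conn (pair_of (P k) r) u' u.
Proof. by rewrite /conn conn_sym. Qed.

Let color x y : white x -> white y = false -> x != y.
Proof. by move=> wx wy; apply: contraTneq wx => ->; rewrite wy. Qed.

Lemma quad_flip1_v2 : r1 v2 = r v2.
Proof.
rewrite /r1 /quad_flip1 flip_other // 1?eq_sym //.
- by rewrite eq_sym color.
- by rewrite eq_sym color // white_match wv1.
- by apply: contraNneq n21 => <-; rewrite matchK.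
Qed.

Lemma quad_flip_v1 : r2 v1 = w1.
Proof.
rewrite /r2 /quad_flip flip_other //; first exact: flipl.
- exact: color.
- by rewrite quad_flip1_v2 color // white_match wv2.
- by apply: contraNneq w12 => e;
    rewrite -(matchK r1 w2) -e -/r1 /r1 /quad_flip1 flipl.
Qed.

Let n22' : r1 v2 != w2. Proof. by rewrite quad_flip1_v2. Qed.

Lemma quad_comps1 : comps (extend P r1) setT = comps (extend P r) setT.
Proof.
apply/eqP; rewrite eqn_leq nocut //=; apply: leq_comps_flip_conn => //.
exact: conn_step.
Qed.

(** If the second flip cut off a part [Y], the legs of [Y] in [r] would be among the corners, and
    the cycle of color [c] through [v2] would meet a black one, against [c22] and [c21]. *)
Lemma quad_comps : comps (extend P r2) setT = comps (extend P r) setT.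
Proof.
rewrite -quad_comps1; apply/eqP; rewrite eqn_leq andbC leq_comps_flip_conn //=;
  last exact: conn_step.
rewrite leqNgt; apply/negP =>
  /(flip_cut h22 (conn_step _ _ _))[Y [sY v2Y w2Y st]].
have AY := outside sY v2A v2Y.
have nW x : x \in A -> x != v2 -> x != w2 -> x \notin v2 |: (w2 |: Y).
  by move=> xA h1 h2; rewrite !in_setU1 negb_or h1 negb_or h2 AY.
have v1W : v1 \notin v2 |: (w2 |: Y) by rewrite nW // color.
have w1W : w1 \notin v2 |: (w2 |: Y) by rewrite nW // eq_sym color.
have [M [stM YM /subsetP EM v2M]] : exists M, [/\ stable r M, Y \subset M,
    M :\: Y \subset [set v2; w2; v1; w1] & v2 \in M].
  have [stM|stM] := unflip_stable h11 st v1W w1W; [exists (v2 |: (w2 |: Y)) |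
    exists (v1 |: (w1 |: (v2 |: (w2 |: Y))))]; split=> //;
    rewrite ?in_setU1 ?eqxx ?orbT //; apply/subsetP => x;
    rewrite ?in_setD !in_setU1 ?in_set0; do ?[by move=> ->; rewrite !orbT];
    rewrite !inE; case: (x \in Y) => //=; rewrite ?orbF.
  - by case/orP => ->; rewrite ?orbT.
  - by case/or4P => ->; rewrite ?orbT.
have v2E : v2 \in M :\: Y by rewrite in_setD AY.
have [y yE /andP[wy cy]] := balance_transfer (f := P c) stM (sY c) YM v2E.
move: (EM y yE) wy cy; rewrite !inE => /orP[/orP[/orP[]|]|] /eqP-> //.
- by rewrite eqxx.
- by rewrite (negbTE c22).
- by rewrite wv1 wv2.
- by rewrite (negbTE c21).
Qed.

(** The first flip makes [w1], [v1] an edge, so the rest of the face becomes a path of colors 0 and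
    [j] from [v2] to [w2]. The second flip thus finds two shared cycles and repairs a possible loss
    from the first. *)
Lemma quad_bicycles : bicycles P r setT <= bicycles P r2 setT.
Proof.
have b1 : 1 <= \sum_(l < 3) conn (pair_of (P l) r) v1 w1.
  by rewrite (bigD1 i) //= (Pl i v1).
have ji : j != i by rewrite eq_sym.
have b2 : 2 <= \sum_(l < 3) conn (pair_of (P l) r1) v2 w2.
  rewrite (bigD1 i) //= (bigD1 j) //=.
  have -> : conn (pair_of (P i) r1) v2 w2
    by apply: conn_extendl (fun=> P i) r1 tt v2.
  suff -> : conn (pair_of (P j) r1) v2 w2 by [].
  apply: conn_trans (_ : conn _ v2 w1) _.
    by rewrite /conn conn_sym; apply: conn_extendl (fun=> P j) r1 tt w1.
  apply: conn_trans (_ : conn _ w1 v1) _.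
    by rewrite -[X in conn _ _ X](flipr r h11); apply: conn_extendr.
  rewrite -[X in conn _ X _]face /conn conn_sym.
  exact: conn_extendl (fun=> P j) r1 tt w2.
exact: leq_two_flips (bicycles_flip P h11 n11) (bicycles_flip P h22 n22') b1 b2.
Qed.

Section Tight.

Variable s : matching white.
Hypothesis sP : preserves P s.
Hypothesis tight : #|whites white setT| + comps (extend P r2) setT
    <= comps P setT + cycles s r2 setT.

Let sA u : u \in A -> s u \in A.
Proof. by rewrite !inE => /conn_trans; apply. Qed.

(* The legs by which the part Y cut off by u, s u is attached to A in r are
   u, s u and possibly v1, w1 or v2, w2; in all cases their cycles force
   r2 u = s u. *)
Lemma quad_tight u : u \in A -> white u -> r2 u = s u.
Proof.
move=> uA wu; apply/eqP/negPn/negP => nu; set u' := s u in nu.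
have u'A : u' \in A by apply: sA.
have wu' : white u' = false by rewrite white_match wu.
have huu' : white u != white u' by rewrite wu wu'.
have [Y [sY uY u'Y st]] := tight_cut sP tight nu.
rewrite -/u' in u'Y st; have AY := outside sY uA uY.
have r2nA x : x \in [set u; u'] -> r2 x \notin A.
  move=> xu; apply/negP => r2A; have := AY _ r2A; have := st x.
  rewrite !in_setU1; move: xu; rewrite !inE => /orP[]/eqP->;
    rewrite eqxx ?orbT => /(_ isT).
    case/or3P=> [/eqP e|/eqP e|->//]; last by rewrite e eqxx in nu.
    by have := white_match r2 u; rewrite e wu.
  case/or3P=> [/eqP e|/eqP e|->//]; first by rewrite -e matchK eqxx in nu.
  by have := white_match r2 u'; rewrite e wu'.
(* Corners are mapped by [r2] into [A], whereas [u] and [u'] are mapped into [Y]. *)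
have uN x : x \in A -> r2 x \in A -> (u != x) * (u' != x).
  move=> xA rxA; split; apply: contraTneq rxA => <-; apply: r2nA;
  by rewrite !inE eqxx ?orbT.
have r2v1 : r2 v1 \in A by rewrite quad_flip_v1.
have r2w1 : r2 w1 \in A by rewrite -quad_flip_v1 matchK.
have r2v2 : r2 v2 \in A by rewrite /r2 /quad_flip flipl.
have r2w2 : r2 w2 \in A by rewrite /r2 /quad_flip flipr.
have [uv1 u'v1] := uN _ v1A r2v1; have [uw1 u'w1] := uN _ w1A r2w1.
have [uv2 u'v2] := uN _ v2A r2v2; have [uw2 u'w2] := uN _ w2A r2w2.
have r2u : r1 u = u' -> False.
  move=> e; case/negP: nu; rewrite /r2 /quad_flip flip_other ?e ?eqxx //.
    by rewrite quad_flip1_v2 color // white_match wv2.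
  by apply: contraNneq u'w2 => eu; rewrite -e eu matchK.
pose W := u |: (u' |: Y).
have nW x : x \in A -> u != x -> u' != x -> x \notin W.
  by move=> xA h1 h2; rewrite !in_setU1 !negb_or ![x == _]eq_sym h1 h2 AY.
have v1W := nW _ v1A uv1 u'v1; have w1W := nW _ w1A uw1 u'w1.
have v2W := nW _ v2A uv2 u'v2; have w2W := nW _ w2A uw2 u'w2.
have YW : Y \subset W by apply/subsetP => x xY; rewrite !in_setU1 xY !orbT.
have WY x : x \in W -> x \notin Y -> x \in [set u; u'].
  by rewrite !in_setU1 !inE => /or3P[->|->|->//]; rewrite ?orbT.
have eW : W = u |: (u' |: Y) by [].
rewrite -/W in st; clearbody W.
have inE4 (a b x : V) : x \in a |: (b |: W) -> x \notin Y ->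
    [|| x == a, x == b, x == u | x == u'].
  rewrite !in_setU1 => /or3P[->|->|xW] xY; rewrite ?orbT //.
  by have := WY x xW xY; rewrite !inE => /orP[]->; rewrite !orbT.
(* If undoing the flips adds just the legs [v] and [w], their cycles of colors [j] and [c] can only
   end at [u'] and [u]; two shared cycles then force [r v = u'] and [r w = u]. *)
have two_legs v w : v \in A -> w \in A -> white v -> white w = false ->
    stable r (v |: (w |: W)) -> ~~ conn (pair_of (P j) r) v w ->
    ~~ conn (pair_of (P c) r) v w -> r v != u' \/ r w != u -> False.
  move=> vA wA wv ww stM njvw ncvw.
  have YM : Y \subset v |: (w |: W).
    by apply: subset_trans YW _; apply/subsetP => x xW;
      rewrite !in_setU1 xW !orbT.
  have legs k : ~~ conn (pair_of (P k) r) v w ->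
      conn (pair_of (P k) r) v u' /\ conn (pair_of (P k) r) w u.
    move=> nk; split.
      have vE : v \in (v |: (w |: W)) :\: Y
        by rewrite in_setD AY // !in_setU1 eqxx.
      have [y /setDP[yM yY] /andP[wy ky]] := balance_transfer stM (sY k) YM vE.
      case/or4P: (inE4 _ _ _ yM yY) wy ky => /eqP-> //; first by rewrite eqxx.
        by rewrite (negbTE nk).
      by rewrite wu wv.
    have wE : w \in (v |: (w |: W)) :\: Y.
      by rewrite in_setD AY // !in_setU1 eqxx orbT.
    have [y /setDP[yM yY] /andP[wy ky]] := balance_transfer stM (sY k) YM wE.
    case/or4P: (inE4 _ _ _ yM yY) wy ky => /eqP-> //.
    - by rewrite symc (negbTE nk).
    - by rewrite eqxx.
    - by rewrite wu' ww.
  have [jv jw] := legs j njvw; have [cv cw] := legs c ncvw.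
  have -> : r v = u' by apply: (share vA u'A _ cj cv jv); rewrite wv wu'.
  have -> : r w = u by apply: (share wA uA _ cj cw jw); rewrite ww wu.
  by rewrite !eqxx => -[].
(* Undoing each flip either leaves the legs alone or adds its pair of corners: four cases. *)
have [st1|st1] := unflip_stable h22 st v2W w2W.
  have [st0|st0] := unflip_stable h11 st1 v1W w1W.
    have ru : r u = u'.
      apply/eqP/negPn/negP => n0; have := nocut uA u'A huu' n0.
      have cutY : is_cut P r u u' Y by split=> //; rewrite -eW.
      by rewrite leqNgt (cut_flip huu' n0 cutY) //; apply: sP.
    apply: r2u; rewrite /r1 /quad_flip1 flip_other //.
      by rewrite color // white_match wv1.
    by apply: contraNneq u'w1 => e; rewrite -ru e matchK.
  apply: (two_legs v1 w1) => //.
  have [rv1|] := eqVneq (r v1) u'; last by left.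
  have [rw1|] := eqVneq (r w1) u; last by right.
  by case: r2u; rewrite -rw1 /r1 /quad_flip1 flip_nbrr.
have nW2 x : x \in A -> u != x -> u' != x -> v2 != x -> w2 != x ->
    x \notin v2 |: (w2 |: W).
  move=> xA h1 h2 h3 h4.
  by rewrite in_setU1 in_setU1 !negb_or nW // eq_sym h3 eq_sym h4.
have [||st0|st0] := unflip_stable h11 st1.
- by apply: nW2 => //; rewrite eq_sym // color.
- by apply: nW2 => //; rewrite eq_sym // eq_sym color.
- apply: (two_legs v2 w2) => //.
  have [rv2|] := eqVneq (r v2) u'; last by left.
  have [rw2|] := eqVneq (r w2) u; last by right.
  have r1w2 : r1 w2 = u.
    rewrite /r1 /quad_flip1 flip_other //.
    + by rewrite eq_sym color.
    + by rewrite eq_sym.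
    + by rewrite eq_sym.
    + by rewrite eq_sym color // white_match ww1.
  case/negP: nu; rewrite -r1w2 /r2 /quad_flip flip_nbrr //.
  by rewrite quad_flip1_v2 rv2.
set M := v1 |: _ in st0.
have YM : Y \subset M.
  by apply: subset_trans YW _; apply/subsetP => x xW;
    rewrite !in_setU1 xW !orbT.
have inE6 x : x \in M -> x \notin Y ->
    [|| x == v1, x == w1, x == v2, x == w2, x == u | x == u'].
  rewrite 2!in_setU1 => /or3P[->|->|xW] xY; rewrite ?orbT //.
  by rewrite (inE4 v2 w2 x xW xY) !orbT.
have to_u' v : v \in [set v1; v2] ->
    [/\ v \in M :\: Y, white v & forall y, y \in M -> y \notin Y ->
      ~~ white y ->
       conn (pair_of (P c) r) v y -> y = u'].
  move=> v_in; have [vA wv vM nvw1 nvw2] : [/\ v \in A, white v, v \in M,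
      ~~ conn (pair_of (P c) r) v w1 & ~~ conn (pair_of (P c) r) v w2].
    by case/set2P: v_in => ->; split; rewrite // /M !in_setU1 eqxx ?orbT.
  split=> //; first by rewrite in_setD AY.
  move=> y yM yY; case/or4P: (inE6 y yM yY) => [/eqP->|/eqP->|/eqP->|];
    rewrite ?wv1 ?wv2 ?(negbTE nvw1) //.
  by case/or3P=> /eqP->; rewrite ?wu ?(negbTE nvw2).
(* All six legs are present. In color [c] the black corners are out of reach of [v1] and [v2], so
   both lead to [u']; one cycle then has two white legs and a single black one, against
   [balance]. *)
have cu' v : v \in [set v1; v2] -> conn (pair_of (P c) r) v u'.
  case/to_u' => vE wv Hy.
  have [y /setDP[yM yY] /andP[wy cy]] := balance_transfer st0 (sY c) YM vE.
  by rewrite -(Hy y yM yY) //; rewrite wv in wy; case: (white y) wy.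
have v1_in : v1 \in [set v1; v2] by rewrite !inE eqxx.
have v2_in : v2 \in [set v1; v2] by rewrite !inE eqxx orbT.
have [v1E _ Hv1] := to_u' _ v1_in; have [v2E _ _] := to_u' _ v2_in.
pose C := component (pair_of (P c) r) v1.
have fC : stable (P c) C :=
  @component_stable V white _ (pair_of (P c) r) (Some tt) v1.
have rC : stable r C := @component_stable V white _ (pair_of (P c) r) None v1.
have := balance st0 (sY c) YM fC rC; apply/eqP; rewrite gtn_eqF //.
apply: (@leq_ltn_trans #|[set u']|).
  apply/subset_leq_card/subsetP => y /setIdP[/setIP[yC /setDP[yM yY]] wy].
  by rewrite inE; apply/eqP/Hv1 => //; rewrite inE in yC.
rewrite cards1; have <- : #|[set v1; v2]| = 2 by rewrite cards2 v12.
apply/subset_leq_card/subsetP => y /set2P y_in; apply/setIdP.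
have c2 : conn (pair_of (P c) r) v1 v2.
  by apply: conn_trans (cu' _ v1_in) _; rewrite symc; apply: cu'.
by case: y_in => ->; rewrite in_setI ?v1E ?v2E ?wv1 ?wv2 inE ?c2 ?conn_refl.
Qed.

(** Both flips occur inside connected parts and lose no component, so P + r2 and P + r have the same
    components; as [r2] agrees with [s] on [A], the component of P + r containing [A] is [A]
    itself. *)
Lemma quad_component_stable : stable r A.
Proof.
have r2A : stable r2 A.
  move=> x xA; case wx : (white x); first by rewrite quad_tight // sA.
  have := quad_tight (sA xA); rewrite white_match wx => /(_ isT).
  by rewrite matchK => e; rewrite -[X in r2 X]e matchK sA.
have sub : subrel (conn (extend P r2)) (conn (extend P r)).
  move=> x y /(sub_conn_flip h22) h; apply: (sub_conn_flip h11).
    exact/sub_conn_extend/conn_step.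
  exact/h/sub_conn_extend/conn_step.
have back := eq_ncc_connect (conn_sym _) (conn_sym _) sub (eq_leq quad_comps).
move=> x xA; have c2 : conn (extend P r2) x (r x).
  by apply: back; rewrite ?inE //; apply: conn_extendr.
by rewrite -(conn_extend_stable A_stable r2A c2).
Qed.

End Tight.

End Quadrangle.

(** * The bound for planar components *)

Section Planar.

Variables (V : finType) (white : pred V).
Implicit Types (f r s : matching white) (Y M S B : {set V}).
Implicit Types P : 'I_3 -> matching white.

(** [S] is the planar part still to be treated and [B] the exceptional component; everywhere else
    [r] already preserves the components of [P]. *)
Definition admissible P r B S :=
  forall x, x \notin S -> x \in B \/ conn P x (r x).

Definition good_below n := forall P r B S, #|S| < n ->
  (forall l, stable (P l) S) -> planar_on P S -> [disjoint B & S] ->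
  {in B &, forall x y, conn P x y} -> admissible P r B S -> good P r.

Lemma good_preserves P r : preserves P r -> good P r.
Proof.
move=> rP; exists r => //; right.
have eK : comps (extend P r) setT = comps P setT.
  apply: eq_comps_in => x _ y; apply/idP/idP; last exact: sub_conn_extend.
  by apply: sub_conn => -[l|] z; [apply: conn_step | apply: rP].
suff leC : #|whites white setT| <= cycles r r setT 
  by rewrite eK; split=> //; rewrite addnC leq_add2l.
have injC : {in whites white setT &, injective (root (graph (pair_of r r)))}.
  move=> x y /setIdP[_ wx] /setIdP[_ wy] /(rootP (conn_sym _)) cxy.
  have st o : stable (pair_of r r o) [set x; r x].
    by move=> z /set2P[]->; case: o => [[]|];
      rewrite /= ?matchK !inE eqxx ?orbT.
  have := conn_stable st cxy; rewrite !inE eqxx => /esym/orP[/eqP//|/eqP e].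
  by rewrite e white_match wx in wy.
rewrite -(card_in_imset injC); apply/subset_leq_card/imsetS/subsetT.
Qed.

Lemma admissible_flip P r B S u u' : (forall l, stable (P l) S) ->
  u \in S -> u' \in S -> white u != white u' ->
  admissible P r B S -> admissible P (flip r u u') B S.
Proof.
move=> sS uS u'S hu adm x xS.
have out z : z \in S -> r z \notin S -> r z \in B.
  move=> zS rzS; case: (adm _ rzS) => //; rewrite matchK => c.
  by rewrite (conn_stable sS c) zS in rzS.
case: (flipP r hu x) => [e|e|e|e|_ _ _ _]; last exact: adm.
- by rewrite e uS in xS.
- by rewrite e u'S in xS.
- by left; rewrite e; apply: out => //; rewrite -e.
- by left; rewrite e; apply: out => //; rewrite -e.
Qed.

(** After contraction the pair is a component preserved by [r] and can leave [S]; connections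
    between points outside [S] are untouched. *)
Lemma good_contract_step n P r B S x l : good_below n -> #|S| <= n ->
  (forall l, stable (P l) S) -> planar_on P S -> [disjoint B & S] ->
  {in B &, forall x y, conn P x y} -> admissible P r B S ->
  x \in S -> r x = P l x -> good P r.
Proof.
move=> IH leS sS pl dis conB adm xS rx.
have hx := white_matchN (P l) x; set w := P l x in hx rx.
apply: (good_contract hx rx (erefl w)).
have wS : w \in S by apply: sS.
have agree z : z \in ~: S -> forall l', P l' z = contract x w P l' z.
  rewrite inE => zS l'; rewrite /contract flip_other //;
    by apply: contraNneq zS => ->; rewrite ?stable_mem.
have conn_out z z' : z \notin S -> conn P z z' = conn (contract x w P) z z'.
  move=> zS; apply: (@conn_agree _ _ _ _ _ (~: S)); rewrite ?inE //.
    by move=> l'; apply/stableC/sS.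
  by move=> l' y yS; apply: agree.
apply: (IH _ _ B (S :\: [set x; w])).
- by apply: leq_trans leS; apply: card_contractD.
- exact: (contract_stableD hx sS (erefl w)).
- exact: (planar_contract hx sS xS (erefl w)).
- by apply: disjointWr dis; apply: subsetDl.
- by move=> y z yB zB; rewrite -conn_out ?conB // (disjointFr dis).
- move=> y; rewrite in_setD negb_and negbK => /orP[/set2P[->|->]|yS].
  + by right; rewrite rx -[X in conn _ _ X](flipl (P l) hx);
      apply: (conn_step (contract x w P)).
  + right; rewrite -rx matchK rx -[X in conn _ _ X](flipr (P l) hx).
    exact: (conn_step (contract x w P)).
  + by rewrite -conn_out //; apply: adm.
Qed.

(** A crude bound that keeps the truncated subtraction in the measure of [good_planar] exact. *)
Lemma bicycles_bound P r : bicycles P r setT <= 3 * #|V|.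
Proof.
rewrite /bicycles -[X in X * _](card_ord 3) -sum_nat_const;
  apply: leq_sum => i _.
by rewrite -cardsT; apply: leq_imset_card.
Qed.

Lemma third_color (i j : 'I_3) : i != j -> exists2 c, c != i & c != j.
Proof.
move=> ij; have : ~~ ([set: 'I_3] \subset [set i; j]).
  by apply/negP => /subset_leq_card; rewrite cardsT card_ord cards2 ij.
by case/subsetPn => c _; rewrite !inE negb_or => /andP[]; exists c.
Qed.

Lemma good_planar n : good_below n.
Proof.
elim: n => [|n IH] P r B S //; rewrite ltnS => leS sS pl dis conB.
(* With no planar part left, an [r]-edge leaving [B] would have an outer end at which [r] preserves
   components; so [r] preserves all of them. *)
have [S0|[x0 x0S]] := set_0Vmem S.
  move=> adm; apply: good_preserves => x.
  have cadm z : z \in B \/ conn P z (r z) by apply: adm; rewrite S0 inE.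
  case: (cadm x) => // xB; case: (cadm (r x)) => [rxB|]; first exact: conB.
  by rewrite matchK /conn conn_sym.
(* The factor is 2 rather than 3 so that both kinds of improvement lower the measure: a
   disconnecting flip adds one component and at least 3 cycles, any other improving flip keeps the
   components and adds cycles. *)
pose measure r := 3 * #|V| + 2 * comps (extend P r) setT - bicycles P r setT.
elim: {r}(measure r).+1 {-2}r (ltnSn (measure r)) => // m IHm r.
rewrite ltnS => lem adm.
pose better r' := comps (extend P r) setT < comps (extend P r') setT
  \/ bicycles P r setT + 3 * comps (extend P r') setT
     < bicycles P r' setT + 3 * comps (extend P r) setT.
have improve u u' : u \in S -> u' \in S -> white u != white u' ->
    conn P u u' -> r u != u' -> better (flip r u u') -> good P r.
  move=> uS u'S hu cu nu bet.
  have leK := leq_comps_unflip r hu P setT.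
  have geK := leq_comps_flip_conn r hu cu.
  have bnd := bicycles_bound P r; have bnd' := bicycles_bound P (flip r u u').
  have adm' := admissible_flip sS uS u'S hu adm.
  have raise := raise_bicycles_flip hu nu cu.
  have gr : measure (flip r u u') < m -> good P (flip r u u') by move=> lt;
    apply: IHm.
  rewrite /measure in lem gr.
  case: (ltnP (comps (extend P r) setT) (comps (extend P (flip r u u')) setT))
    => cmp.
    have {}raise := raise cmp; apply: (good_flip hu) => //; first by lia.
    by apply: gr; lia.
  case: bet => [|bet]; first by rewrite ltnNge cmp.
  by apply: (good_lt bet); apply: gr; lia.
have [/existsP[u /existsP[u' /and5P[uS u'S hu cu /andP[nu bet]]]]|none] :=
  boolP [exists u, [exists u', [&& u \in S, u' \in S, white u != white u',
    conn P u u', r u != u' &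
    (comps (extend P r) setT < comps (extend P (flip r u u')) setT) ||
    (bicycles P r setT + 3 * comps (extend P (flip r u u')) setT
     < bicycles P (flip r u u') setT + 3 * comps (extend P r) setT)]]].
  by apply: (improve u u') => //; case/orP: bet; [left|right].
have {improve} worse u u' : u \in S -> u' \in S -> white u != white u' ->
    conn P u u' -> r u != u' ->
    comps (extend P (flip r u u')) setT <= comps (extend P r) setT /\
    bicycles P (flip r u u') setT + 3 * comps (extend P r) setT
      <= bicycles P r setT + 3 * comps (extend P (flip r u u')) setT.
  move=> uS u'S hu cu nu; apply/andP;
    rewrite leqNgt [X in _ && X]leqNgt -negb_or.
  apply: contra none => bet; apply/existsP; exists u; apply/existsP; exists u'.
  by rewrite uS u'S hu cu nu.
(* Two shared cycles would gain at least 2 * 2 - 3 = 1 bicycle without reducing psi through the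
   components: an improving flip. *)
have share u u' k l : u \in S -> u' \in S -> conn P u u' ->
    white u != white u' -> k != l -> conn (pair_of (P k) r) u u' ->
    conn (pair_of (P l) r) u u' -> r u = u'.
  move=> uS u'S cu hu kl ck cl; apply/eqP/negPn/negP => nu.
  have [leK leF] := worse u u' uS u'S hu cu nu.
  have := bicycles_flip P hu nu; rewrite (bigD1 k) //= (bigD1 l) 1?eq_sym //=.
  by rewrite ck cl; move: leK leF; clear; lia.
have step := good_contract_step IH leS sS pl dis conB.
have [i [j [v1 [ij v1S wv1 face]]]] := small_face sS pl x0S.
have [/existsP[x /existsP[l /andP[xS /eqP rx]]]|noP] :=
  boolP [exists x, [exists l, (x \in S) && (r x == P l x)]].
  exact: (step _ x l adm).
have {}noP x l : x \in S -> r x != P l x.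
  move=> xS; apply: contra noP => rx; apply/existsP; exists x; apply/existsP.
  by exists l; rewrite xS.
pose w1 := P i v1; pose v2 := P j w1; pose w2 := P i v2.
have w1S : w1 \in S by apply: sS.
have v2S : v2 \in S by apply: sS.
have w2S : w2 \in S by apply: sS.
(* A face of length 2 would make [v1] and [w1] share two cycles, so [r] would contain an edge of
   [P], a case already settled. *)
have v12 : v1 != v2.
  apply/eqP => e; have := noP v1 i v1S; rewrite -/w1 => /negP[]; apply/eqP.
  apply: (share v1 w1 i j) => //.
  - exact: conn_step.
  - exact: white_matchN.
  - exact: (conn_extendl (fun=> P i) r tt).
  - by rewrite e /v2 /conn conn_sym; apply: (conn_extendl (fun=> P j) r tt).
have n12 : r v1 != w2 by rewrite -[w2](matchK (P j)) face; apply: noP.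
have n21 : r v2 != w1 by rewrite -[w1](matchK (P j)); apply: noP.
have [c ci cj] := third_color ij.
pose A := component P v1.
have sA l : stable (P l) A by apply: component_stable.
have AS : A \subset S.
  by apply/subsetP => x; rewrite inE => cx; rewrite -(conn_stable sS cx).
have cA u u' : u \in A -> u' \in A -> conn P u u'.
  by rewrite !inE => c1 c2; apply: conn_trans c2; rewrite /conn conn_sym.
have shareA u u' k l : u \in A -> u' \in A ->
    white u != white u' -> k != l -> conn (pair_of (P k) r) u u' ->
    conn (pair_of (P l) r) u u' -> r u = u'.
  by move=> uA u'A; apply: share (cA _ _ uA u'A); apply: (subsetP AS).
have nocut u u' : u \in A -> u' \in A -> white u != white u' -> r u != u' ->
    comps (extend P (flip r u u')) setT <= comps (extend P r) setT.
  move=> uA u'A hu nu.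
  by have [] := worse u u' (subsetP AS _ uA) (subsetP AS _ u'A) hu (cA _ _ uA
    u'A) nu.
pose r2 := quad_flip P r v1 i j.
have eK : comps (extend P r2) setT = comps (extend P r) setT.
  by apply: (@quad_comps _ _ _ _ _ _ _ c) => //; apply: noP.
have leB : bicycles P r setT <= bicycles P r2 setT.
  by apply: quad_bicycles => //; apply: noP.
have r2v1 : r2 v1 = P i v1 by apply: quad_flip_v1 => //; apply: noP.
have adm2 : admissible P r2 B S.
  apply: admissible_flip => //; first exact: white_matchN.
  by apply: admissible_flip => //; apply: white_matchN.
have [s sP h] := step _ v1 i adm2 v1S r2v1.
(* Since psi r is at most psi r2, a failure of strictness for [r] leaves only the case of equality
   for [r2]. *)
have [lt|ge] := ltnP (bicycles P r setT + 3 * comps P setT)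
  (bicycles P s setT + 3 * comps (extend P r) setT).
  by exists s => //; left.
have tight : #|whites white setT| + comps (extend P r2) setT
    <= comps P setT + cycles s r2 setT.
  by case: h => [|[_ //]]; rewrite eK; move: ge leB; clear; lia.
have rA : stable r A.
  by apply: (@quad_component_stable _ _ _ _ _ _ _ c) tight => //; apply: noP.
apply: (IH P r B (S :\: A)).
- apply: leq_trans leS; apply/proper_card/properP; split; first exact: subsetDl.
  by exists v1; rewrite // !inE conn_refl.
- by move=> l; apply: stableD.
- exact: planarD.
- by apply: disjointWr dis; apply: subsetDl.
- exact: conB.
- move=> x; rewrite in_setD negb_and negbK => /orP[xA|xS]; last exact: adm.
  by right; apply: cA => //; apply: rA.
Qed.

End Planar.

(** * Undoing cuts, and joining components *)

Section CutsAndJoins.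

Variables (V : finType) (white : pred V).
Implicit Types (f r s : matching white) (Y M S B : {set V}).
Implicit Types P : 'I_3 -> matching white.

Lemma preserves_stable P s Y :
  preserves P s -> (forall i, stable (P i) Y) -> stable s Y.
Proof. by move=> sP sY x xY; rewrite -(conn_stable sY (sP x)). Qed.

(** A flip along a cut adds a component and at most three bicycles, so psi does not grow on the way
    from [r] to [s]. *)
Lemma cuts_bicycles P r s : preserves P s ->
  (forall u, r u != s u -> exists Y, is_cut P r u (s u) Y) ->
  bicycles P s setT + 3 * comps (extend P r) setT
    <= bicycles P r setT + 3 * comps P setT.
Proof.
move=> sP; elim: {r}_.+1 {-2}r (ltnSn #|[set x | r x != s x]|) =>
  // n IH r ltn cuts.
have [agree|[x]] := set_0Vmem [set x | r x != s x].
  have rs x : r x = s x.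
    by apply/eqP; have := in_set0 x; rewrite -agree inE => /negbFE.
  have -> : bicycles P s setT = bicycles P r setT.
    by apply: eq_bigr => i _; apply: eq_cycles => [y|y|y|y]; rewrite ?inE.
  rewrite leq_add2l leq_mul2l /=; apply: leq_ncc; first exact: conn_sym.
  exact: sub_conn_extend.
rewrite inE => rsx; have hx := white_matchN s x; pose r' := flip r x (s x).
have [Y cutY] := cuts x rsx.
have ltK := cut_flip hx rsx cutY (sP x).
have leB : bicycles P r' setT <= bicycles P r setT + 3.
  rewrite -[X in _ + X](card_ord 3) -sum1_card -big_split /=.
  by apply: leq_sum => i _; rewrite addn1; apply: leq_comps_unflip.
have := IH r' (leq_trans (card_flip_disagree rsx) ltn).
(* The other cuts survive: the set cut off together with its two legs is stable under [s], hence
   contains both of [x] and [s x] or neither. *)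
have cuts' u : r' u != s u -> exists Y', is_cut P r' u (s u) Y'.
  have [ru|/eqP ru _] := r u =P s u; first by rewrite /r' flip_agree // eqxx.
  have [Y' [sY nu nsu st]] := cuts u ru; exists Y'; split => //.
  apply: flip_stable => //; rewrite stable_mem // => y.
  rewrite !in_setU1 => /or3P[/eqP->|/eqP->|yY].
  - by rewrite eqxx orbT.
  - by rewrite matchK eqxx.
  - by rewrite (preserves_stable sP sY yY) !orbT.
by move=> /(_ cuts'); move: ltK leB; rewrite -/r'; clear; lia.
Qed.

(** If the flip separated [v] from [r v], the part of [r v] would have had the legs [v] and [w], and
    [balance_transfer] would put them on a common cycle before the flip. *)
Lemma join_flip P r v w : white v != white w ->
  ~~ conn (extend P r) v w ->
  comps (extend P (flip r v w)) setT < comps (extend P r) setT.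
Proof.
move=> hvw ncon; set F := extend P (flip r v w).
have vw : conn F v w by rewrite -[X in conn _ _ X](flipl r hvw);
  apply: conn_extendr.
apply: (@ltn_ncc _ _ _ _ v w) => //; rewrite ?inE //; try exact: conn_sym.
apply: sub_conn_unflip => //; apply/negPn/negP => nv.
pose Y := component F (r v).
have sP i : stable (P i) Y := @component_stable V white _ F (Some i) (r v).
have sf : stable (flip r v w) Y := @component_stable V white _ F None (r v).
have vY : v \notin Y by rewrite inE /conn conn_sym.
have sF o : stable (F o) Y by apply: component_stable.
have wY : w \notin Y by rewrite -(conn_stable sF vw).
have rvY : r v \in Y by apply: mem_component.
have rwY : r w \in Y by rewrite -(flip_nbrl r hvw) sf.
have stM : stable r (v |: (w |: Y)).
  move=> x; rewrite !in_setU1 => /or3P[/eqP->|/eqP->|xY].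
  - by rewrite rvY !orbT.
  - by rewrite rwY !orbT.
  - have := sf x xY; case: (flipP r hvw x) => [e|e|->|->|_ _ _ _ ->];
      rewrite ?(negbTE vY) ?(negbTE wY) ?matchK ?eqxx ?orbT //.
have YM : Y \subset v |: (w |: Y) by apply/subsetP => x xY;
  rewrite !in_setU1 xY !orbT.
have vE : v \in (v |: (w |: Y)) :\: Y by rewrite in_setD vY in_setU1 eqxx.
have [y yE /andP[wy cy]] := balance_transfer stM (sP ord0) YM vE.
move: yE; rewrite in_setD !in_setU1 => /andP[/negbTE->].
case/or3P => // /eqP ey; rewrite {}ey in wy cy; first by rewrite eqxx in wy.
by case/negP: ncon; apply: sub_conn_pair_of cy.
Qed.

(** Each flip at vertices in different components removes at least one component and at most one
    cycle of each color, that is, three bicycles. *)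
Lemma join_components P s : 0 < #|V| ->
  exists2 r, (forall x y, conn (extend P r) x y) &
    bicycles P s setT + 3 <= bicycles P r setT + 3 * comps (extend P s) setT.
Proof.
move=> V_gt0; elim: {s}(comps (extend P s) setT).+1 {-2}s (ltnSn (comps (extend
  P s) setT)) => // n IH s ltn.
have [con|] := boolP [forall x, forall y, conn (extend P s) x y].
  have {}con x y : conn (extend P s) x y by move/forallP/(_ x)/forallP: con;
    apply.
  exists s => //; case/card_gt0P: V_gt0 => x _.
  rewrite leq_add2l -[X in X <= _]muln1 leq_mul2l /=.
  by apply/card_gt0P; exists (root (graph (extend P s)) x); apply: imset_f.
rewrite negb_forall => /existsP[v]; rewrite negb_forall => /existsP[w' nvw].
have [w [hvw {}nvw]] : exists w, white v != white w /\ ~~ conn (extend P s) v w.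
  have [e|] := eqVneq (white v) (white w'); last by exists w'.
  exists (s w'); split; first by rewrite white_match e; case: (white w').
  apply: contra nvw => c; apply: conn_trans c _.
  by rewrite /conn conn_sym; apply: conn_extendr.
have ltK := join_flip hvw nvw.
have [r con le] := IH (flip s v w) (leq_trans ltK ltn).
exists r => //; apply: leq_trans (_ : bicycles P (flip s v w) setT + 6 <= _).
  rewrite -[6]/(3 + 3) addnA leq_add2r -[X in _ + X](card_ord 3) -sum1_card
    -big_split /=.
  by apply: leq_sum => i _; rewrite addn1; apply: leq_comps_flip.
by move: le ltK; clear; lia.
Qed.

End CutsAndJoins.

(** * Colored graphs and edge cuts *)

Section ColoredGraphs.

Variables (D : finType) (G : ecgraph D).

Definition nbr_match (c : D) : matching (@white D G) :=
  Matching (nbrK c) (white_nbr c).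

Lemma edge_at_ends c (u z : G) :
  (edge_at c u == edge_at c z) = (u == z) || (u == nbr c z).
Proof.
rewrite -val_eqE /= xpair_eqE eqxx /= /white_end.
case: ifP => wu; case: ifP => wz.
- have [->//|_] /= := eqVneq u z; apply/esym/eqP => e.
  by have := white_nbr c z; rewrite -e wu wz.
- have [e|_] //= := eqVneq u z; by rewrite e wz in wu.
- have [e|_] /= := eqVneq u z; first by rewrite e wz in wu.
  by rewrite -(inj_eq (inv_inj (@nbrK _ G c))) nbrK.
- rewrite (inj_eq (inv_inj (@nbrK _ G c))); have [//|_] /= := eqVneq u z.
  apply/esym/eqP => e; have := white_nbr c z; by rewrite -e wu wz.
Qed.

Lemma edge_at_nbr c (u : G) : edge_at c (nbr c u) = edge_at c u.
Proof. by apply/eqP; rewrite edge_at_ends eqxx orbT. Qed.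

Lemma edge_at_inj c c' (u z : G) : edge_at c u = edge_at c' z -> c = c'.
Proof. by move/(congr1 (fun e => (val e).1)). Qed.

Lemma adjE (A : {set edge G}) (u v : G) :
  adj A u v = [exists c, (edge_at c u \in A) && (nbr c u == v)].
Proof.
apply/existsP/existsP => [[e /andP[eA]]|[c /andP[cA /eqP<-]]]; last first.
  by have /existsP := adj_edge_at cA.
have eE x : x = wend e -> edge_at (ecol e) x = e.
  move=> ->; apply: val_inj; rewrite /= /white_end (valP e : white (wend e)).
  by rewrite /ecol /wend -surjective_pairing.
case/orP => /andP[/eqP eu /eqP ev]; exists (ecol e).
  by rewrite eE // eA ev eu eqxx.
by rewrite eu ev /bend edge_at_nbr eE // eA nbrK eqxx.
Qed.

Lemma adj_sym (A : {set edge G}) : symmetric (adj A).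
Proof. by move=> u v; apply: eq_existsb => e;
  rewrite orbC ![_ && (v == _)]andbC. Qed.

Lemma ncomp_ncc (A : {set edge G}) : ncomp A = ncc (adj A) setT.
Proof.
rewrite ncc_n_comp //; first by apply: eq_n_comp_r => x; rewrite !inE.
exact/sym_connect_sym/adj_sym.
Qed.

Lemma ncomp1P (A : {set edge G}) (x : G) :
  ncomp A = 1 <-> forall u v, connect (adj A) u v.
Proof.
have sym : connect_sym (adj A) by exact/sym_connect_sym/adj_sym.
rewrite ncomp_ncc; split; first exact: ncc1_connected.
by move=> con; apply: ncc_connected => //; exists x; rewrite inE.
Qed.

Lemma n_bicyclesE a b : n_bicycles G a b = cycles (nbr_match a) (nbr_match b)
  setT.
Proof.
rewrite /n_bicycles ncomp_ncc; apply: eq_ncc; [|exact: conn_sym|move=> x _ y].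
  exact/sym_connect_sym/adj_sym.
apply: eq_connect => {x y} x y; rewrite adjE; apply/existsP/existsP.
  case=> c; rewrite !inE /ecol /= => /andP[/orP[]/eqP-> h];
    first by exists (Some tt).
  by exists None.
by case=> -[[]|] h; [exists a | exists b]; rewrite !inE /= eqxx ?orbT.
Qed.

Lemma connected_conn : is_connected G ->
  (exists x : G, True) /\ forall x y, conn nbr_match x y.
Proof.
rewrite /is_connected ncomp_ncc => con; split.
  have : 0 < ncc (adj [set: edge G]) setT by rewrite con.
  by case/card_gt0P => _ /imsetP[x _ _]; exists x.
have sym : connect_sym (adj [set: edge G]) by exact/sym_connect_sym/adj_sym.
move=> x y; rewrite /conn -(@eq_connect _ (adj [set: edge G]));
  first exact: ncc1_connected.
move=> u v; rewrite adjE; apply: eq_existsb => c; by rewrite inE.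
Qed.

End ColoredGraphs.

Section FourColors.

Variable G : ecgraph 'I_4.

Definition bubble_match (i : 'I_3) := nbr_match G (lift ord0 i).
Definition color0_match := nbr_match G ord0.

Lemma C0E : C0 G = bicycles bubble_match color0_match setT.
Proof. by apply: eq_bigr => i _; rewrite n_bicyclesE cyclesC. Qed.

Lemma bubbleE v : bubble v = component bubble_match v.
Proof.
apply/setP => u; rewrite !inE; apply: eq_connect => {u v} x y; rewrite adjE.
apply/existsP/existsP => [[c]|[i h]]; last by exists (lift ord0 i); rewrite inE.
rewrite inE /= /ecol /=; have [i ->|->] := unliftP ord0 c; last by rewrite eqxx.
by case/andP=> _ h; exists i.
Qed.

Lemma connected_conn4 : is_connected G ->
  forall x y, conn (extend bubble_match color0_match) x y.
Proof.
move=> /connected_conn[_ con] x y; have := con x y.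
apply: sub_conn => c z; have [i ->|->] := unliftP ord0 c.
  exact: (conn_extendl bubble_match).
exact: (conn_extendr bubble_match color0_match).
Qed.

Section EdgeCut.

Hypothesis connG : is_connected G.

Variables (x y : G).
Hypotheses (hxy : white x != white y) (cxy : conn bubble_match x y)
  (nxy : nbr ord0 x != y).

Let P := bubble_match.
Let r := color0_match.
Let F : {set edge G} := [set edge_at ord0 x; edge_at ord0 y].

Let symA (A : {set edge G}) : connect_sym (adj A).
Proof. exact/sym_connect_sym/adj_sym. Qed.

Let color0P (z : G) (A : {set edge G}) : (forall e, e \in A -> ecol e = ord0) ->
  forall i, connect (adj (~: A)) z (P i z).
Proof.
move=> A0 i; apply/connect1/adj_edge_at; rewrite inE; apply/negP => /A0.
by move/(congr1 val).
Qed.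

Let keep (A : {set edge G}) z : edge_at ord0 z \notin A ->
  connect (adj (~: A)) z (r z).
Proof. by move=> zA; apply/connect1/adj_edge_at; rewrite inE. Qed.

Let connect_all (A : {set edge G}) :
  (forall e, e \in A -> ecol e = ord0) ->
  (forall z, edge_at ord0 z \in A -> connect (adj (~: A)) z (r z)) ->
  ncomp (~: A) = 1.
Proof.
move=> A0 cA; apply/(ncomp1P _ x) => u v.
have := connected_conn4 connG u v; apply: connect_sub => {u v} u v.
case/existsP=> -[i|] /eqP<-; first exact: color0P.
by have [/cA//|/keep] := boolP (edge_at ord0 u \in A).
Qed.

(* The (0,1)-colored cycle through a color 0 edge connects its ends without
   using it. *)
Let no_bridge (z : G) (A : {set edge G}) : A \subset [set edge_at ord0 z] ->
  ncomp (~: A) = 1.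
Proof.
move=> /subsetP Az; apply: connect_all => [e /Az|u /Az]; rewrite inE;
  first by move/eqP->.
suff cz : connect (adj (~: A)) z (r z).
  by rewrite edge_at_ends => /orP[]/eqP-> //; rewrite [r _]nbrK symA.
rewrite symA => {u}; apply/negPn/negP => nz.
pose Y := [set u | connect (adj (~: A)) (r z) u].
have A0 e : e \in A -> ecol e = ord0 by move/Az; rewrite inE => /eqP->.
have sP i : stable (P i) Y.
  by move=> u; rewrite !inE => /connect_trans; apply; apply: color0P.
have zY : z \notin Y by rewrite inE.
have st : stable r (z |: Y).
  move=> u; rewrite !in_setU1 => /orP[/eqP->|uY];
    first by rewrite inE connect0 orbT.
  have [->|urz] := eqVneq u (r z); first by rewrite matchK eqxx.
  rewrite !inE in uY *; rewrite (connect_trans uY) ?orbT //; apply: keep.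
  apply/negP => /Az; rewrite inE edge_at_ends (negbTE (urz : u != nbr ord0 z))
    orbF.
  by move=> /eqP e; rewrite e (negbTE nz) in uY.
have YM : Y \subset z |: Y by apply/subsetP => u uY; rewrite in_setU1 uY orbT.
have zE : z \in (z |: Y) :\: Y by rewrite in_setD zY in_setU1 eqxx.
have [u /setDP[uM uY] /andP[wu _]] := balance_transfer st (sP ord0) YM zE.
move: uM; rewrite in_setU1 (negbTE uY) orbF => /eqP e.
by rewrite e eqxx in wu.
Qed.

Let edge_neq : edge_at ord0 x != edge_at ord0 y.
Proof.
rewrite edge_at_ends negb_or (opp_color hxy) /=; apply: contra nxy => /eqP->.
by rewrite nbrK.
Qed.

Let F0 e : e \in F -> ecol e = ord0.
Proof. by case/set2P => ->. Qed.

(** Without the two edges [Y] is closed, and a proper subset of [F] lies in one color 0 edge, which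
    is no bridge. Each edge has one end in the bubble because its ends lie on different sides of
    [Y], a union of bubbles. *)
Lemma cut_edge_cut Y v : x \in bubble v -> is_cut P r x y Y ->
  edge_cut 2 F /\ incident_on F (bubble v).
Proof.
move=> xv [sP xY yY st].
have hx : white x != white (r x) by apply: white_matchN.
have hy : white y != white (r y) by apply: white_matchN.
have rxY : r x \in Y.
  have := st x; rewrite !in_setU1 eqxx => /(_ isT)/or3P[/eqP e|/eqP e|//].
    by rewrite e eqxx in hx.
  by have := nxy; rewrite [nbr _ _]e eqxx.
have ryY : r y \in Y.
  have := st y; rewrite !in_setU1 eqxx orbT => /(_ isT)/or3P[/eqP e|/eqP e|//].
    by have := nxy; rewrite -e [nbr _ _](matchK r) eqxx.
  by rewrite e eqxx in hy.
split; last first.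
  have xB : x \in component P v by rewrite -bubbleE.
  have yB : y \in component P v.
    by move: xB; rewrite !inE => h; apply: conn_trans h cxy.
  have nB z : z \in component P v -> r z \in Y -> z \notin Y ->
      (z \in bubble v) (+) (r z \in bubble v).
    rewrite bubbleE => zB rzY zY; rewrite zB /= inE.
    apply: contra zY => h; rewrite inE in zB.
    have zr : conn P z (r z) by apply: conn_trans h; rewrite /conn conn_sym.
    by rewrite (conn_stable sP zr).
  have inc z : z \in component P v -> r z \in Y -> z \notin Y ->
      ecol (edge_at ord0 z) = ord0 /\
      (wend (edge_at ord0 z) \in bubble v) (+) (bend (edge_at ord0 z) \in
        bubble v).
    move=> zB rzY zY; split=> //; have := nB z zB rzY zY.
    rewrite /bend /wend /ecol /= /white_end; case: ifP => // _.
    by rewrite nbrK addbC.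
  by move=> e /set2P[]->; apply: inc.
split.
- by rewrite cards2 edge_neq.
- apply/negP => /eqP/(ncomp1P _ x)/(_ (r x) x) con.
  have := @connect_to_closed _ (adj (~: F)) Y _ _ _ con rxY.
  rewrite (negbTE xY) => H; suff: false by []; apply: H => u w uY.
  rewrite adjE => /existsP[c /andP[+ /eqP<-]]; rewrite inE.
  have [i -> _|->] := unliftP ord0 c; first exact: sP.
  rewrite !inE !edge_at_ends !negb_or => /andP[/andP[ux urx] /andP[uy ury]].
  have := st u; rewrite !in_setU1 uY !orbT => /(_ isT)/or3P[/eqP e|/eqP e|//].
    by rewrite -e [nbr _ _](matchK r) eqxx in urx.
  by rewrite -e [nbr _ _](matchK r) eqxx in ury.
- move=> F' /properP[/subsetP sF [e eF eF']].
  case/set2P: eF => e0; subst e; [apply: (@no_bridge y)|apply: (@no_bridge x)];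
    apply/subsetP => e' e'F'; have /set2P[e1|e1] := sF _ e'F';
      rewrite inE e1 //;
    by rewrite -e1 e'F' in eF'.
Qed.

(** [Y] is what [x] cannot reach without [F]. By minimality both edges of [F] lead into it: an edge
    whose ends remained connected could be left out of the cut. *)
Lemma edge_cut_cut : edge_cut 2 F -> exists Y, is_cut P r x y Y.
Proof.
case=> _ dis min; pose Y := [set z | ~~ connect (adj (~: F)) x z].
have xy : connect (adj (~: F)) x y.
  by move: cxy; apply: connect_sub => u w /existsP[i /eqP<-];
    apply: color0P F0 _.
have sub_min z : z \in [set x; y] -> r z \in Y.
  move=> zF; rewrite inE; apply/negP => cx.
  have cz : connect (adj (~: F)) z (r z).
    by case/set2P: zF cx => -> // h; apply: connect_trans h; rewrite symA.
  case/negP: dis; apply/eqP/(ncomp1P _ x) => u w.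
  have zeF : edge_at ord0 z \in F by case/set2P: zF => ->;
    rewrite !inE eqxx ?orbT.
  have /(ncomp1P _ x)/(_ u w) := min _ (properD1 zeF).
  apply: connect_sub => {u w} u w; rewrite adjE => /existsP[c /andP[+ /eqP<-]].
  rewrite in_setC in_setD1 negb_and negbK.
  have [uF|uF _] := boolP (edge_at c u \in F); last first.
    by apply/connect1/adj_edge_at; rewrite inE.
  rewrite orbF => /eqP e; have ec := edge_at_inj e; subst c.
  by move/eqP: e; rewrite edge_at_ends => /orP[]/eqP-> //; rewrite nbrK symA.
have xF : x \in [set x; y] by rewrite !inE eqxx.
have yF : y \in [set x; y] by rewrite !inE eqxx orbT.
exists Y; split.
- by move=> i z; rewrite !inE; apply: contra => h; apply: connect_trans h _;
    rewrite symA; apply: color0P F0 _.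
- by rewrite inE connect0.
- by rewrite inE xy.
- move=> z; rewrite !in_setU1 => /or3P[/eqP->|/eqP->|zY].
  + by rewrite sub_min ?orbT.
  + by rewrite sub_min ?orbT.
  + have [zF|zF] := boolP (edge_at ord0 z \in F); last first.
      rewrite [_ \in Y]inE; apply/orP; right; apply/orP; right.
      move: zY; rewrite inE; apply: contra => h; apply: connect_trans h _.
      by rewrite symA; apply: keep.
    move: zF; rewrite !inE !edge_at_ends -orbA => /or4P[]/eqP ez.
    * by move: zY; rewrite ez inE connect0.
    * by rewrite ez [r _]nbrK eqxx.
    * by move: zY; rewrite ez inE xy.
    * by rewrite ez [r _]nbrK eqxx orbT.
Qed.

End EdgeCut.

End FourColors.

Lemma ncc_transfer (T T' : finType) (h : T -> T') (e : rel T) (e' : rel T') S :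
  connect_sym e -> connect_sym e' ->
  (forall x y, connect e x y = connect e' (h x) (h y)) ->
  ncc e S = ncc e' (h @: S).
Proof.
move=> sym sym' eqc; rewrite /ncc -imset_comp.
have rt z : root e' (h (root e z)) = root e' (h z).
  by apply/esym/(rootP sym'); rewrite -eqc connect_root.
have -> : (root e' \o h) @: S = (root e' \o h) @: (root e @: S).
  by rewrite -imset_comp; apply: eq_imset => z /=; rewrite rt.
rewrite [RHS]card_in_imset // => _ _ /imsetP[x _ ->] /imsetP[y _ ->] /=.
by rewrite !rt => /(rootP sym'); rewrite -eqc => /(rootP sym).
Qed.

(** * Faces of the canonical map *)

Section CanonicalMapFaces.

Variable B : ecgraph 'I_3.

Let w := @white _ B.
Let P := nbr_match B.

Let fcard_ncc (T : finType) (f : T -> T) : injective f ->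
  fcard f predT = ncc (frel f) setT.
Proof.
move=> injf; rewrite ncc_n_comp //; last exact: fconnect_sym.
by apply: eq_n_comp_r => x; rewrite !inE.
Qed.

Let frel_lab (T : finType) (J : Type) (f : T -> T) (lab : T -> J) :
  (forall x, lab (f x) = lab x) -> forall x y, frel f x y -> lab x = lab y.
Proof. by move=> lf x y /eqP<-. Qed.

Lemma card_sigma_orbits : fcard (@can_sigma B) predT = #|B|.
Proof.
have inj := @can_sigma_inj B; have sym := fconnect_sym inj.
rewrite fcard_ncc // (@ncc_partition _ _ fst) //; last exact: frel_lab.
rewrite -[RHS]sum1_card; apply: eq_bigr => v _.
apply: ncc_connected => //; first by exists (v, ord0); rewrite !inE eqxx.
have c1 (c : 'I_3) : fconnect (@can_sigma B) (v, c) (v, ordS c).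
  rewrite /can_sigma; case wv : (white v).
    by apply: connect1; rewrite /= /can_sigma /= wv.
  by rewrite sym; apply: connect1; rewrite /= /can_sigma /= wv ordSK.
have c2 (c c' : 'I_3) : fconnect (@can_sigma B) (v, c) (v, c').
  case/or3P: (ordS3E c c') => /eqP->; first exact: connect0.
    exact: c1.
  exact: connect_trans (c1 _) (c1 _).
by move=> [u c] [u' c']; rewrite !inE /= => /eqP-> /eqP->.
Qed.

Lemma card_alpha_orbits : fcard (@can_alpha B) predT = 3 * #|whites w setT|.
Proof.
have inj := inv_inj (@can_alphaK B); have sym := fconnect_sym inj.
pose lab (d : B * 'I_3) := (d.2, white_end d.2 d.1).
rewrite fcard_ncc // (@ncc_partition _ _ lab) //; last first.
  apply: frel_lab => -[v c];
    rewrite /lab /can_alpha /white_end /= white_nbr nbrK.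
  by case: (white v).
have e (p : 'I_3 * B) : ncc (frel (@can_alpha B)) [set x in setT | lab x == p]
  = white p.2.
  case: p => c u; case wu : (white u); last first.
    rewrite (_ : [set _ in _ | _] = set0) ?ncc_set0 //; apply/setP => -[v c'].
    rewrite !inE /lab /=; apply/eqP => -[_ e].
    by have := white_white_end c' v; rewrite e wu.
  apply: ncc_connected => //; first by exists (u, c);
    rewrite !inE /lab /white_end /= wu.
  have cu d : d \in [set x in setT | lab x == (c, u)] ->
    fconnect (@can_alpha B) (u, c) d.
    case: d => v c'; rewrite !inE /lab /white_end /= => /eqP[-> <-].
    case: ifP => _; first exact: connect0.
    by apply: connect1; rewrite /= /can_alpha /= nbrK.
  by move=> d d' /cu; rewrite sym => h /cu; apply: connect_trans.
under eq_bigr do rewrite e.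
rewrite -(pair_big predT predT (fun _ (u : B) =>
  white u : nat)) /= sum_nat_const card_ord.
congr (3 * _); rewrite -sum1_card big_mkcond [RHS]big_mkcond /=.
by apply: eq_bigr => u _; rewrite /whites !inE /w; case: (white u).
Qed.

(** An orbit leaves its white vertices by color c + 1 and its black ones by color c, for one fixed
    c, which [lab] computes; it runs around one cycle of these two colors. *)
Lemma card_face_orbits :
  fcard (@can_sigma B \o @can_alpha B) predT = faces P setT.
Proof.
set f := _ \o _; have inj : injective f.
  exact: inj_comp (@can_sigma_inj B) (inv_inj (@can_alphaK B)).
have sym := fconnect_sym inj.
pose lab (d : B * 'I_3) := if white d.1 then ord_pred d.2 else d.2.
have fE v c : f (v, c) = (nbr c v, if white v then ord_pred c else ordS c).
  by rewrite /f /= /can_sigma /can_alpha /= white_nbr; case: (white v).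
rewrite fcard_ncc // (@ncc_partition _ _ lab) //; last first.
  apply: frel_lab => -[v c]; rewrite fE /lab /= white_nbr;
    case: (white v) => //=.
  by rewrite ordSK.
apply: eq_bigr => c _; rewrite cyclesC.
(* The one dart at [v] with label [c], so orbits of darts correspond to cycles of vertices. *)
pose h (v : B) := (v, if white v then ordS c else c).
have fh v : f (h v) = h (if white v then nbr (ordS c) v else nbr c v).
  by rewrite fE /h; case wv : (white v); rewrite white_nbr wv //= ordSK.
have -> : [set x in setT | lab x == c] = h @: setT.
  apply/setP => -[v c']; rewrite !inE /lab /=;
    apply/eqP/imsetP => [|[u _ [-> ->]]].
    by case wv : (white v) => ec; exists v;
      rewrite ?inE // /h wv -?ec ?ord_predK.
  by case: (white u) => //; rewrite ordSK.
apply/esym/ncc_transfer => //; first exact: conn_sym.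
move=> x y; apply/idP/idP => [|cxy]; last first.
  have := @connect_to_closed _ (frel f) (h @: [set z | conn (pair_of (P (ordS
    c)) (P c)) x z]) _ _ _ cxy.
  rewrite imset_f ?inE ?conn_refl // => H.
  have /imsetP[z] : h y \in h @: [set z | conn (pair_of (P (ordS c)) (P c)) x
    z].
    apply: H => // u v' /imsetP[z zS ->] /eqP<-; rewrite fh; apply: imset_f.
    rewrite inE in zS; rewrite inE; apply: conn_trans zS _.
    by case: (white z); [apply: conn_extendl (fun=> P (ordS c)) _ tt _ | apply:
      conn_extendr].
  by rewrite inE => cz [->].
have step u v : f (h u) = h v -> fconnect f (h u) (h v).
  by move=> e; apply: connect1; rewrite /= e.
have {}cxy : subrel (conn (pair_of (P (ordS c)) (P c))) (fun u v =>
  fconnect f (h u) (h v)).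
  move=> u v uv.
  have := @connect_to_closed _ (graph (pair_of (P (ordS c)) (P c)))
    [set z | fconnect f (h u) (h z)] _ _ _ uv.
  rewrite !inE connect0 => -> // a b; rewrite !inE => ca /existsP[o /eqP<-].
  apply: connect_trans ca _; case: o => [[]|]; rewrite /=; case wa : (white a).
  - by apply: step; rewrite fh wa.
  - by rewrite sym; apply: step; rewrite fh white_nbr wa nbrK.
  - by rewrite sym; apply: step; rewrite fh white_nbr wa nbrK.
  - by apply: step; rewrite fh wa.
exact: cxy.
Qed.

(** With p white vertices there are 2p vertices and 3p edges, so genus 0 means that the number of
    faces is p + 2. *)
Lemma planar_faces : planar B -> faces P setT = #|whites w setT| + 2.
Proof.
have cB : #|B| = 2 * #|whites w setT|.
  have -> : #|B| = #|whites w setT| + #|blacks w setT|.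
    rewrite -cardsT -(cardsID [set x | w x]); congr (_ + _);
      apply: eq_card => x.
      by rewrite !inE.
    by rewrite !inE andbT.
  by rewrite -(@card_whites_blacks _ w (P ord0)) ?mul2n ?addnn.
rewrite /planar /genus /= card_sigma_orbits card_alpha_orbits card_face_orbits.
move: (faces P setT) => F; rewrite cB; move: #|whites w setT| => p.
move/eqP; rewrite subr_eq0 => /eqP/(congr1 (fun q : rat => q * 2%:R)%R).
rewrite mul1r divfK ?pnatr_eq0 // => /esym/eqP.
rewrite addrAC subr_eq -!natrD eqr_nat => /eqP.
by lia.
Qed.

End CanonicalMapFaces.

(** * Bubbles inside a graph *)

Section Embedding.

Variables (V : finType) (white : pred V) (T : finType) (wT : pred T).
Variables (h : T -> V).

Lemma embed_conn (I : finType) (F : I -> matching wT) (F' : I ->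
  matching white) :
  injective h -> (forall i x, h (F i x) = F' i (h x)) ->
  forall x y, conn F x y = conn F' (h x) (h y).
Proof.
move=> injh hF x y; apply/idP/idP => [xy|].
  have := @conn_stable _ _ _ F [set z | conn F' (h x) (h z)] x y _ xy.
  rewrite !inE conn_refl => <- // i z; rewrite !inE hF => c.
  exact: conn_trans c (conn_step _ _ _).
have st i : stable (F' i) (h @: component F x).
  move=> _ /imsetP[z zC ->]; rewrite -hF; apply: imset_f.
  exact: component_stable zC.
move=> /(conn_stable st); rewrite imset_f ?mem_component // => /esym/imsetP[z].
by rewrite inE => cz /injh->.
Qed.

Lemma embed_comps (I : finType) (F : I -> matching wT) (F' : I ->
  matching white) S :
  injective h -> (forall i x, h (F i x) = F' i (h x)) ->
  comps F S = comps F' (h @: S).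
Proof. by move=> injh hF; apply: ncc_transfer (embed_conn injh hF);
  apply: conn_sym. Qed.

Lemma embed_cycles (f r : matching wT) (f' r' : matching white) S :
  injective h -> (forall x, h (f x) = f' (h x)) ->
    (forall x, h (r x) = r' (h x)) ->
  cycles f r S = cycles f' r' (h @: S).
Proof. by move=> injh hf hr; apply: embed_comps => // -[[]|]. Qed.

End Embedding.

Section EmbeddedBubble.

Variables (V : finType) (white : pred V) (P : 'I_3 -> matching white).

(** Identifies [B] with a stable part of [V]. Bubbles of a graph, models of labelled bubbles and
    summands of a disjoint union are all handled through it. *)
Definition embedding (B : ecgraph 'I_3) (h : B -> V) :=
  [/\ injective h, forall x, white (h x) = Defs.white x &
      forall i x, h (nbr i x) = P i (h x)].

Variables (B : ecgraph 'I_3) (h : B -> V).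
Hypothesis emb : embedding h.

Let injh : injective h. Proof. by case: emb. Qed.
Let wh x : white (h x) = Defs.white x. Proof. by case: emb. Qed.
Let hP i x : h (nbr i x) = P i (h x). Proof. by case: emb. Qed.

Let A := h @: [set: B].

Let hA x : h x \in A. Proof. by apply: imset_f; rewrite inE. Qed.

Lemma embedding_stable i : stable (P i) A.
Proof. by move=> _ /imsetP[x _ ->]; rewrite -hP. Qed.

Lemma embedding_conn x y : conn (nbr_match B) x y = conn P (h x) (h y).
Proof. exact: embed_conn. Qed.

Lemma embedding_planar : is_connected B -> planar B -> planar_on P A.
Proof.
move=> conB /planar_faces; have [[x0 _] con] := connected_conn conB.
have -> : faces (nbr_match B) setT = faces P A.
  by apply: eq_bigr => i _; apply: embed_cycles => // x; apply: hP.
have -> : #|whites (@Defs.white _ B) setT| = #|whites white A|.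
  rewrite -(card_imset _ injh); apply: eq_card => z; apply/imsetP/setIdP.
    by case=> x /setIdP[_ wx] ->; rewrite hA wh.
  by case=> /imsetP[x _ ->]; rewrite wh => wx; exists x => //; apply/setIdP;
    rewrite inE.
rewrite /planar_on => ->; congr (_ + _); rewrite -[LHS]muln1; congr (2 * _).
apply/esym/ncc_connected; [exact: conn_sym | by exists (h x0) |].
by move=> _ _ /imsetP[x _ ->] /imsetP[y _ ->];
  rewrite -/(conn _ _ _) -embedding_conn.
Qed.

Lemma C0_close (pi : pairing B) (s : matching white) :
  (forall x, h (partner pi x) = s (h x)) -> C0 (close pi) = bicycles P s A.
Proof.
move=> hs; rewrite C0E; apply: eq_bigr => i _.
apply: (@embed_cycles _ _ _ _ h) => // x.
  by rewrite /= /close_nbr liftK hP.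
by rewrite /= /close_nbr unlift_none hs.
Qed.

Lemma restrict_pairing s : preserves P s ->
  exists pi : pairing B, forall x, h (partner pi x) = s (h x).
Proof.
move=> sP; have sA x : exists y, h y == s (h x).
  have : s (h x) \in A by rewrite -(conn_stable embedding_stable (sP (h x))).
  by case/imsetP => y _ ->; exists y.
pose g := [ffun x => xchoose (sA x)].
have hg x : h (g x) = s (h x) by rewrite ffunE; apply/eqP/(xchooseP (sA x)).
have g_pairing : is_pairing g.
  apply/forallP => x; rewrite -!wh hg white_match eqxx andbT.
  by apply/eqP/injh; rewrite !hg matchK.
by exists (exist _ g g_pairing).
Qed.

Hypothesis conA : {in A &, forall x y, conn P x y}.

Lemma extend_pairing (pi : pairing B) :
  exists2 s, preserves P s & forall x, h (partner pi x) = s (h x).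
Proof.
have piK x : partner pi (partner pi x) = x.
  by have /andP[/eqP] := forallP (valP pi) x.
have pi_white x : Defs.white (partner pi x) = ~~ Defs.white x.
  by have /andP[_ /eqP] := forallP (valP pi) x.
(* Outside the image the matching only has to preserve the components of [P]; [P ord0] is an
   arbitrary such choice. *)
pose g z := if [pick x | h x == z] is Some x then h (partner pi x) else P ord0
  z.
have gh x : g (h x) = h (partner pi x).
  rewrite /g; case: pickP => [y /eqP/injh->//|/(_ x)]; by rewrite eqxx.
have gN z : z \notin A -> g z = P ord0 z.
  move=> zA; rewrite /g; case: pickP => [y /eqP ey|//].
  by rewrite -ey hA in zA.
have NA z : z \notin A -> P ord0 z \notin A.
  by move=> zA; rewrite stable_mem //; apply: embedding_stable.
have gK : involutive g.
  move=> z; have [/imsetP[x _ ->]|zA] := boolP (z \in A);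
    first by rewrite !gh piK.
  by rewrite !gN ?NA // matchK.
have gw z : white (g z) = ~~ white z.
  have [/imsetP[x _ ->]|zA] := boolP (z \in A);
    first by rewrite gh !wh pi_white.
  by rewrite gN // white_match.
exists (Matching gK gw) => [z|x]; last exact/esym/gh.
rewrite -[Matching _ _ z]/(g z).
have [/imsetP[x _ ->]|zA] := boolP (z \in A); first by rewrite gh; apply: conA.
by rewrite gN //; apply: conn_step.
Qed.

Lemma leq_C1 s : preserves P s -> bicycles P s A <= C1 B.
Proof.
move=> sP; have [pi hpi] := restrict_pairing sP.
by rewrite -(C0_close hpi); apply: leq_bigmax.
Qed.

Lemma C1_attained : exists2 s, preserves P s & bicycles P s A = C1 B.
Proof.
(* The matching of the first color is a pairing, so the maximum is over a nonempty set and is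
   attained. *)
have p0 : is_pairing [ffun x : B => nbr ord0 x].
  by apply/forallP => x; rewrite !ffunE nbrK white_nbr !eqxx.
have [|pi e] := @eq_bigmax (pairing B) (fun pi => C0 (close pi)).
  by apply/card_gt0P; exists (exist (fun p => is_pairing p) _ p0).
have [s sP hs] := extend_pairing pi; exists s => //.
by rewrite /C1 e (C0_close hs).
Qed.

End EmbeddedBubble.

(** Both numbers are the maximum of [bicycles P s] on the common image over all [s] preserving [P];
    this stands in for the invariance of [C1] under isomorphism. *)
Lemma C1_unique (V : finType) (white : pred V) (P : 'I_3 -> matching white)
  (B B' : ecgraph 'I_3) (h : B -> V) (h' : B' -> V) :
  embedding P h -> embedding P h' -> h @: setT = h' @: setT ->
  {in h @: setT &, forall x y, conn P x y} -> C1 B = C1 B'.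
Proof.
move=> emb emb' eA con; have con' := con; rewrite eA in con'.
have [s sP sE] := C1_attained emb con; have [s' sP' sE'] :=
  C1_attained emb' con'.
have := leq_C1 emb sP'; have := leq_C1 emb' sP.
by rewrite -eA sE eA sE' => *; apply/eqP; rewrite eqn_leq; apply/andP.
Qed.

Section BubbleGraph.

Variable G : ecgraph 'I_4.

Lemma bubble_embedding (v : G) :
  embedding (bubble_match G) (val : bubble_graph v -> G).
Proof. by split => //; apply: val_inj. Qed.

Lemma bubble_image (v : G) : val @: [set: bubble_graph v] = bubble v.
Proof.
apply/setP => u; apply/imsetP/idP => [[x _ ->]|ub]; first exact: valP x.
by exists (exist _ u ub).
Qed.

Lemma bubble_conn (v : G) : {in bubble v &, forall x y,
  conn (bubble_match G) x y}.
Proof.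
move=> x y; rewrite bubbleE !inE => vx vy; apply: conn_trans vy.
by rewrite /conn conn_sym.
Qed.

End BubbleGraph.

(** * Graphs partitioned into labelled bubbles *)

Section LabelledBubbles.

Variables (V : finType) (white : pred V) (P : 'I_3 -> matching white).
Variables (J : finType) (model : J -> ecgraph 'I_3) (h : forall j, model j ->
  V).
Arguments h : clear implicits.
Variable lab : V -> J.

Hypothesis model_connected : forall j, is_connected (model j).
Hypothesis emb : forall j, embedding P (h j).
Hypothesis image_h : forall j, h j @: setT = [set x | lab x == j].

Lemma lab_image j x : lab (h j x) = j.
Proof.
apply/eqP; have := image_h j => /setP/(_ (h j x)).
by rewrite imset_f ?inE // => <-.
Qed.

Lemma lab_preimage j z : lab z = j -> exists x, z = h j x.
Proof.
move=> zj; have : z \in h j @: setT by rewrite image_h inE zj.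
by case/imsetP => x _ e; exists x.
Qed.

Lemma lab_match i x : lab (P i x) = lab x.
Proof.
have [j xj] : exists j, lab x = j by exists (lab x).
have [y ->] := lab_preimage xj; have [_ _ hP] := emb j.
by rewrite -hP !lab_image.
Qed.

Lemma conn_lab x y : conn P x y = (lab x == lab y).
Proof.
apply/idP/eqP => [c|e].
  have st i : stable (P i) [set z | lab z == lab x].
    by move=> z; rewrite !inE lab_match.
  by have := conn_stable st c; rewrite !inE eqxx => /esym/eqP.
have [j yj] : exists j, lab y = j by exists (lab y).
rewrite yj in e; have [x' ->] := lab_preimage e;
  have [y' ->] := lab_preimage yj.
rewrite -embedding_conn //.
by have [_] := connected_conn (model_connected j); apply.
Qed.

Lemma conn_label j : {in [set x | lab x == j] &, forall x y, conn P x y}.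
Proof. by move=> x y; rewrite !inE conn_lab => /eqP-> /eqP->. Qed.

Lemma conn_image j : {in h j @: setT &, forall x y, conn P x y}.
Proof. by rewrite image_h; apply: conn_label. Qed.

Lemma preserves_lab s : preserves P s -> forall x, lab (s x) = lab x.
Proof. by move=> sP x; have := sP x; rewrite conn_lab => /eqP. Qed.

Lemma comps_label (I : finType) (F : I -> matching white) S :
  (forall i x, lab (F i x) = lab x) ->
  comps F S = \sum_j comps F [set x in S | lab x == j].
Proof.
move=> labF; apply: ncc_partition; first exact: conn_sym.
by move=> x y /existsP[i /eqP<-].
Qed.

Lemma comps_labels : comps P setT = #|J|.
Proof.
rewrite (comps_label _ lab_match) -sum1_card; apply: eq_bigr => j _.
apply: ncc_connected; first exact: conn_sym.
  have [[x _] _] := connected_conn (model_connected j).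
  by exists (h j x); rewrite !inE lab_image eqxx.
by move=> x y; rewrite !inE -/(conn _ _ _) conn_lab => /eqP-> /eqP->.
Qed.

Lemma bicycles_label s : preserves P s ->
  bicycles P s setT = \sum_j bicycles P s (h j @: setT).
Proof.
move=> sP; rewrite /bicycles exchange_big; apply: eq_bigr => i _.
rewrite /cycles (@comps_label _ (pair_of (P i) s)).
  apply: eq_bigr => j _; congr (comps _ _); rewrite image_h.
  by apply/setP => x; rewrite !inE.
by move=> [[]|] x; [apply: lab_match | apply: preserves_lab].
Qed.

Lemma leq_bicycles_C1 s : preserves P s ->
  bicycles P s setT <= \sum_j C1 (model j).
Proof.
by move=> sP; rewrite bicycles_label //; apply: leq_sum => j _; apply: leq_C1.
Qed.

Lemma eq_bicycles_C1 s : preserves P s ->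
  \sum_j C1 (model j) <= bicycles P s setT ->
  forall j, bicycles P s (h j @: setT) = C1 (model j).
Proof.
move=> sP; rewrite bicycles_label // => le j.
have le1 i : bicycles P s (h i @: setT) <= C1 (model i) by apply: leq_C1.
apply/eqP; rewrite eqn_leq le1 /= leqNgt; apply/negP => lt.
move: le; rewrite leqNgt => /negP[].
rewrite [X in X < _](bigD1 j) //= [X in _ < X](bigD1 j) //= -addSn.
by apply: leq_add => //; apply: leq_sum.
Qed.

(** Matchings that preserve [P] respect the labels, so they can be chosen independently on each
    bubble. *)
Lemma glue_matchings (ss : J -> matching white) : (forall j,
  preserves P (ss j)) ->
  exists2 s, preserves P s &
    forall j, {in [set x | lab x == j], s =1 ss j}.
Proof.
move=> ssP; pose g x := ss (lab x) x.
have lg x : lab (g x) = lab x by apply: preserves_lab.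
have gK : involutive g by move=> x; rewrite {1}/g lg matchK.
have gw x : white (g x) = ~~ white x by apply: white_match.
exists (Matching gK gw) => [x|j x]; first exact: ssP.
by rewrite inE => /eqP <-.
Qed.

Lemma glue_bicycles (ss : J -> matching white) s : (forall j,
  preserves P (ss j)) ->
  preserves P s -> (forall j, {in [set x | lab x == j], s =1 ss j}) ->
  bicycles P s setT = \sum_j bicycles P (ss j) (h j @: setT).
Proof.
move=> ssP sP eqs; rewrite bicycles_label //; apply: eq_bigr => j _.
apply: eq_bigr => i _; rewrite image_h; apply: eq_cycles; last exact: eqs.
- by move=> x; rewrite !inE lab_match.
- by move=> x; rewrite !inE preserves_lab.
- by [].
Qed.

Lemma optimal_matching : exists2 s, preserves P s &
  bicycles P s setT = \sum_j C1 (model j).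
Proof.
have opt j : exists s,
  preserves P s /\ bicycles P s (h j @: setT) = C1 (model j).
  by have [s sP sE] := C1_attained (emb j) (@conn_image j); exists s.
have /fin_all_exists[ss ssP] := opt.
have [s sP es] := glue_matchings (fun j => (ssP j).1).
exists s => //; rewrite (glue_bicycles (fun j => (ssP j).1) sP es).
by apply: eq_bigr => j _; have [] := ssP j.
Qed.

Lemma planar_labels (j0 : J) : (forall j, j != j0 -> planar (model j)) ->
  planar_on P [set x | lab x != j0].
Proof.
move=> pl; set S := [set x | _].
have SE j : [set x in S | lab x == j] = if j == j0 then set0 else h j @: setT.
  apply/setP => x; case: eqP => [->|/eqP nj]; rewrite ?image_h !inE.
    by case: (lab x == j0).
  by have [->|_] := eqVneq (lab x) j; rewrite ?andbF ?nj.
have facesE' : faces P S = \sum_(j | j != j0) faces P (h j @: setT).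
  rewrite /faces exchange_big; apply: eq_bigr => i _.
  rewrite /cycles (@comps_label _ (pair_of (P i) (P (ordS i)))); last first.
    by move=> [[]|] x; apply: lab_match.
  rewrite [RHS]big_mkcond; apply: eq_bigr => j _; rewrite SE.
  by case: (j == j0); rewrite // /comps ncc_set0.
have compsE' : comps P S = \sum_(j | j != j0) comps P (h j @: setT).
  rewrite (comps_label _ lab_match) [RHS]big_mkcond; apply: eq_bigr => j _.
  by rewrite SE; case: (j == j0); rewrite // /comps ncc_set0.
have whitesE : #|whites white S| = \sum_(j | j != j0) #|whites white (h j @:
  setT)|.
  rewrite -sum1_card (partition_big lab (fun j => j != j0)) /=; last first.
    by move=> x /setIdP[]; rewrite inE.
  apply: eq_bigr => j nj; rewrite -sum1_card; apply: eq_bigl => x.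
  rewrite image_h !inE; have [->|_] := eqVneq (lab x) j;
    rewrite ?nj ?andbT ?andbF //.
rewrite /planar_on facesE' whitesE compsE' big_distrr -big_split /=.
by apply: eq_bigr => j nj; apply: embedding_planar => //; apply: pl.
Qed.

Section Bound.

Variables (r : matching white) (j0 : J).
Hypothesis planar_model : forall j, j != j0 -> planar (model j).
Hypothesis r_connected : forall x y, conn (extend P r) x y.

Lemma comps_connected : comps (extend P r) setT = 1.
Proof.
apply: ncc_connected; first exact: conn_sym.
  have [[x _] _] := connected_conn (model_connected j0).
  by exists (h j0 x); rewrite inE.
by move=> x y _ _; apply: r_connected.
Qed.

(** The bubble labelled [j0] is the exceptional component and all others form the planar part, so at
    the start nothing is required of [r]. *)
Lemma good_labelled : good P r.
Proof.
apply: (@good_planar _ _ #|[set x | lab x != j0]|.+1 _ _ [set x | lab x == j0]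
  [set x | lab x != j0]) => //.
- by move=> i x; rewrite !inE lab_match.
- exact: planar_labels.
- rewrite -setI_eq0; apply/eqP/setP => x; rewrite !inE.
  by case: (lab x == j0).
- exact: conn_label.
- by move=> x; rewrite !inE negbK; left.
Qed.

Lemma leq_bicycles_labelled :
  bicycles P r setT + 3 * #|J| <= \sum_j C1 (model j) + 3.
Proof.
have [s sP h'] := good_labelled; have := leq_bicycles_C1 sP.
rewrite comps_connected comps_labels in h'.
by case: h' => [h'|[h' _]]; move: h'; clear; lia.
Qed.

Lemma max_bicycles_tight :
  \sum_j C1 (model j) + 3 <= bicycles P r setT + 3 * #|J| ->
  exists2 s, preserves P s /\ (forall j,
    bicycles P s (h j @: setT) = C1 (model j)) &
    forall u, r u != s u -> exists Y, is_cut P r u (s u) Y.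
Proof.
move=> le; have [s sP h'] := good_labelled; have leC := leq_bicycles_C1 sP.
have [lt|[e tight]] := h'.
  rewrite comps_connected comps_labels in lt.
  by move: lt le leC; clear; lia.
rewrite comps_connected comps_labels in e.
exists s; last by move=> u; apply: tight_cut tight.
by split=> //; apply: eq_bicycles_C1 => //; move: e le leC; clear; lia.
Qed.

Lemma tight_max_bicycles s : preserves P s ->
  \sum_j C1 (model j) <= bicycles P s setT ->
  (forall u, r u != s u -> exists Y, is_cut P r u (s u) Y) ->
  \sum_j C1 (model j) + 3 <= bicycles P r setT + 3 * #|J|.
Proof.
move=> sP le /(cuts_bicycles sP); rewrite comps_connected comps_labels.
by move: le; clear; lia.
Qed.

End Bound.

Lemma join_labelled (j0 : J) : exists2 r, (forall x y, conn (extend P r) x y) &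
  \sum_j C1 (model j) + 3 <= bicycles P r setT + 3 * #|J|.
Proof.
have [s sP sE] := optimal_matching.
have [|r con le] := join_components P s.
  have [[x _] _] := connected_conn (model_connected j0).
  by apply/card_gt0P; exists (h j0 x).
exists r => //; move: le; rewrite sE.
suff -> : comps (extend P s) setT = #|J| by [].
rewrite -comps_labels; apply: eq_comps_in => x _ y; apply/idP/idP;
  last exact: sub_conn_extend.
by apply: sub_conn => -[i|] z; [apply: conn_step | apply: sP].
Qed.

End LabelledBubbles.

(** * Maximality and the maximal 2-cut property *)

Section MaximalGraphs.

Variables (G : ecgraph 'I_4) (J : finType) (model : J -> ecgraph 'I_3).
Variables (h : forall j, model j -> G) (lab : G -> J) (j0 : J).
Arguments h : clear implicits.

Hypothesis G_connected : is_connected G.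
Hypothesis model_connected : forall j, is_connected (model j).
Hypothesis planar_model : forall j, j != j0 -> planar (model j).
Hypothesis emb : forall j, embedding (bubble_match G) (h j).
Hypothesis image_h : forall j, h j @: setT = [set x | lab x == j].

Let P := bubble_match G.
Let r := color0_match G.

Let r_connected := connected_conn4 G_connected.

Lemma bubble_lab v : bubble v = h (lab v) @: setT.
Proof.
rewrite bubbleE image_h; apply/setP => x; rewrite !inE eq_sym.
exact: (conn_lab model_connected emb image_h).
Qed.

Lemma C1_bubble v : C1 (bubble_graph v) = C1 (model (lab v)).
Proof.
apply: (C1_unique (bubble_embedding v) (emb (lab v))); rewrite bubble_image.
  exact: bubble_lab.
exact: bubble_conn.
Qed.

Lemma leq_C0_labelled : C0 G + 3 * #|J| <= \sum_j C1 (model j) + 3.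
Proof. by rewrite C0E;
  apply: (leq_bicycles_labelled model_connected emb image_h planar_model). Qed.

(** A single optimal [s] serves all bubbles: its restriction to each of them is the required
    pairing. *)
Lemma max_2cut_of_max : \sum_j C1 (model j) + 3 <= C0 G + 3 * #|J| ->
  forall v : G, max_2cut v.
Proof.
rewrite C0E => /(max_bicycles_tight model_connected emb image_h planar_model).
case=> // s [sP opt] cuts v.
have [pi hpi] := restrict_pairing (bubble_embedding v) sP.
exists pi.
  rewrite inE (C0_close (bubble_embedding v) hpi) bubble_image C1_bubble.
  by rewrite bubble_lab opt.
move=> u; rewrite hpi; have [e|/eqP ne] := r (val u) =P s (val u);
  first by left.
right; have [Y cutY] := cuts _ ne.
apply: (cut_edge_cut G_connected _ _ _ _ cutY) => //.
- exact: white_matchN.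
- exact: valP u.
Qed.

Lemma max_of_max_2cut : (forall v : G, max_2cut v) ->
  \sum_j C1 (model j) + 3 <= C0 G + 3 * #|J|.
Proof.
(* For each label, the pairing of its bubble is extended to all of [G]; only its values on that
   bubble matter when the matchings are glued. *)
move=> cut2; have bub j : exists ss : matching (@Defs.white _ G),
    [/\ preserves P ss, bicycles P ss (h j @: setT) = C1 (model j) &
     forall x, lab x = j -> r x != ss x -> exists Y, is_cut P r x (ss x) Y].
  have [[x0 _] _] := connected_conn (model_connected j).
  have labv : lab (h j x0) = j by apply: (lab_image image_h).
  have [pi pi_max cut_pi] := cut2 (h j x0).
  have conb : {in val @: [set: bubble_graph (h j x0)] &, forall x y,
    conn P x y}.
    by rewrite bubble_image; apply: bubble_conn.
  have [ss ssP hss] := extend_pairing (bubble_embedding (h j x0)) conb pi.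
  exists ss; split => //.
    rewrite -[j in LHS]labv -bubble_lab -bubble_image.
    rewrite -(C0_close (bubble_embedding _) hss) -[j in RHS]labv -C1_bubble.
    by move: pi_max; rewrite inE => /eqP.
  move=> x xj ne; have xb : x \in bubble (h j x0)
    by rewrite bubble_lab labv image_h inE xj.
  pose u : bubble_graph (h j x0) := exist _ x xb.
  have [e|[cut _]] := cut_pi u.
    by move: ne; rewrite -[x]/(val u) -hss -e eqxx.
  rewrite hss /= in cut; apply: edge_cut_cut cut.
  exact: ssP.
have /fin_all_exists[ss ssP] := bub.
have ssP1 j : preserves P (ss j) by have [] := ssP j.
have [s sP es] := glue_matchings model_connected emb image_h ssP1.
rewrite C0E; apply: (tight_max_bicycles model_connected emb image_h j0) (sP) _
  _ => //.
  rewrite (glue_bicycles model_connected emb image_h ssP1 sP es).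
  by apply: leq_sum => j _; have [_ ->] := ssP j.
move=> u; have us : s u = ss (lab u) u by apply: es; rewrite inE.
by rewrite us; have [_ _] := ssP (lab u); apply.
Qed.

End MaximalGraphs.

(** * Existence of maximal graphs *)

Section DisjointUnion.

Variables (J : finType) (model : J -> ecgraph 'I_3).

Definition union_type : finType := {j : J & model j}.

Definition union_white (p : union_type) := white (tagged p).

Definition union_nbr (i : 'I_3) (p : union_type) : union_type :=
  Tagged (fun j => model j) (nbr i (tagged p)).

Lemma union_nbrK i : involutive (union_nbr i).
Proof. by case=> j x; rewrite /union_nbr /= nbrK. Qed.

Lemma white_union_nbr i p : union_white (union_nbr i p) = ~~ union_white p.
Proof. exact: white_nbr. Qed.

Definition union_match i : matching union_white :=
  Matching (union_nbrK i) (white_union_nbr i).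

Definition union_in (j : J) (x : model j) : union_type :=
  Tagged (fun j => model j) x.

Lemma union_embedding j : embedding union_match (@union_in j).
Proof. by split=> // x y /eqP; rewrite eq_Tagged => /eqP. Qed.

Lemma union_image j : @union_in j @: setT = [set p : union_type | tag p == j].
Proof.
apply/setP => -[j' x]; rewrite inE /=; apply/imsetP/eqP =>
  [[y _ /(congr1 tag)//]|e].
by subst j'; exists x.
Qed.

Section Color0.

Variable r : matching union_white.

Definition union_nbr4 (c : 'I_4) : union_type -> union_type :=
  if unlift ord0 c is Some i then union_nbr i else r.

Lemma union_nbr4K c : involutive (union_nbr4 c).
Proof. by rewrite /union_nbr4; case: unlift => [i|];
  [apply: union_nbrK | apply: matchK]. Qed.

Lemma white_union_nbr4 c p : union_white (union_nbr4 c p) = ~~ union_white p.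
Proof.
by rewrite /union_nbr4; case: unlift => [i|];
  [apply: white_union_nbr | apply: white_match].
Qed.

Definition union_graph : ecgraph 'I_4 := ECGraph union_nbr4K white_union_nbr4.

Lemma union_bubble_match i : bubble_match union_graph i =1 union_match i.
Proof. by move=> p; rewrite /= /union_nbr4 liftK. Qed.

Lemma union_color0_match : color0_match union_graph =1 r.
Proof. by move=> p; rewrite /= /union_nbr4 unlift_none. Qed.

Lemma union_C0 : C0 union_graph = bicycles union_match r setT.
Proof.
rewrite C0E; apply: eq_bigr => i _; apply: eq_cycles => [p|p|p _|p _];
  rewrite ?inE //.
  exact: union_bubble_match.
exact: union_color0_match.
Qed.

Hypothesis model_connected : forall j, is_connected (model j).

Lemma union_bubble v : bubble (v : union_graph) = [set p : union_type | tag p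
  == tag v].
Proof.
rewrite bubbleE; apply/setP => p; rewrite !inE (eq_conn union_bubble_match).
by rewrite (conn_lab model_connected union_embedding union_image) eq_sym.
Qed.

Lemma union_bubble_isomorphic (v : union_graph) :
  isomorphic (bubble_graph v) (model (tag v)).
Proof.
have gP (x : model (tag v)) : union_in x \in bubble v
  by rewrite union_bubble inE; apply/eqP.
pose g x : bubble_graph v := exist _ (union_in x) (gP x).
have injg : injective g.
  by have [inj _ _] := union_embedding (tag v); move=> x y /(congr1 val)/inj.
have surj u : exists x, g x == u.
  have : val u \in @union_in (tag v) @: setT.
    by rewrite union_image -union_bubble; apply: valP u.
  by case/imsetP => x _ e; exists x; apply/eqP/val_inj.
pose f u := xchoose (surj u).
have gf u : g (f u) = u by apply/eqP/(xchooseP (surj u)).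
exists f; split.
- by exists g => // x; apply: injg; rewrite gf.
- by move=> u; rewrite -[in RHS](gf u).
- move=> i u; apply: injg; rewrite gf -{1}(gf u); apply: val_inj.
  by rewrite /= /union_nbr4 liftK.
Qed.

Lemma union_connected : (forall x y, conn (extend union_match r) x y) ->
  (exists x : union_type, True) -> is_connected union_graph.
Proof.
move=> con [x0 _]; apply/(ncomp1P _ (x0 : union_graph)) => x y.
have := con x y; apply: connect_sub => {x y} x y /existsP[[i|] /eqP<-].
  rewrite -[extend _ _ _ _]/(union_match i x) -union_bubble_match.
  by apply/connect1/adj_edge_at; rewrite inE.
rewrite -[extend _ _ _ _]/(r x) -union_color0_match.
by apply/connect1/adj_edge_at; rewrite inE.
Qed.

End Color0.

End DisjointUnion.

(** * The class of graphs with prescribed bubbles *)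

Section Labels.

Variables (N : nat) (n : 'I_N -> nat).

Definition label : finType := option {i : 'I_N & 'I_(n i)}.

Lemma sum_label (F : label -> nat) :
  \sum_j F j =
  F None + \sum_(i < N) \sum_(k < n i) F (Some (Tagged (fun i => 'I_(n i)) k)).
Proof.
rewrite (bigD1 None) //=; congr (_ + _).
rewrite (reindex_omap Some id) /=; last by case.
under eq_bigl do rewrite eqxx.
by rewrite sig_big_dep /=; apply: eq_bigr => -[i k] _.
Qed.

End Labels.

Section Class.

Variables (N : nat) (Bs : 'I_N -> ecgraph 'I_3) (n : 'I_N -> nat).
Variable B : ecgraph 'I_3.
Hypothesis Bs_connected : forall i, is_connected (Bs i).
Hypothesis B_connected : is_connected B.

Let J := label n.
Let mdl : J -> ecgraph 'I_3 := @model N Bs n B.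

Lemma model_connected j : is_connected (mdl j).
Proof. by case: j => [p|]; [apply: Bs_connected | apply: B_connected]. Qed.

Lemma class_labels G : in_class Bs n B G ->
  exists (h : forall j, mdl j -> G) (lab : G -> J),
    (forall j, embedding (bubble_match G) (h j)) /\
    (forall j, h j @: setT = [set x | lab x == j]).
Proof.
case=> conG [r [lab_r iso_r]].
have labP v : exists j : J, v \in bubble (r j).
  by have [j [vj _]] := lab_r v; exists j.
pose lab v := xchoose (labP v).
have lab_mem v : v \in bubble (r (lab v)) := xchooseP (labP v).
have labE v j : (v \in bubble (r j)) = (lab v == j).
  apply/idP/eqP => [vj|<-]; last exact: lab_mem.
  have [j1 [_ uniq_j]] := lab_r v.
  by rewrite -(uniq_j _ (lab_mem v)) (uniq_j _ vj).
have emb j : exists g : mdl j -> G,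
    embedding (bubble_match G) g /\ g @: setT = [set x | lab x == j].
  have [f [[g fK gK] f_white f_nbr]] := iso_r j.
  exists (fun x => val (g x)); split.
    split.
    - by move=> x y /val_inj /(can_inj gK).
    - by move=> x; rewrite -[in RHS](gK x) f_white.
    - move=> i x; rewrite -[RHS]/(val (nbr i (g x))); congr (val _).
      by apply: (can_inj fK); rewrite f_nbr !gK.
  apply/setP => x; rewrite inE -labE; apply/imsetP/idP => [[y _ ->]|xb].
    exact: valP (g y).
  exists (f (exist _ x xb)); rewrite ?inE //.
  by rewrite fK.
have /fin_all_exists[h hP] := emb.
by exists h, lab; split=> j; have [] := hP j.
Qed.

Hypothesis Bs_planar : forall i, planar (Bs i).

Lemma planar_model j : j != None -> planar (mdl j).
Proof. by case: j => [p _|//]; apply: Bs_planar. Qed.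

Lemma leq_C0_class G : in_class Bs n B G ->
  C0 G + 3 * #|J| <= \sum_j C1 (mdl j) + 3.
Proof.
move=> cG; have [h [lab [emb im]]] := class_labels cG.
exact: (leq_C0_labelled cG.1 model_connected planar_model emb im).
Qed.

Lemma max_C0_class : exists2 G, in_class Bs n B G &
  \sum_j C1 (mdl j) + 3 <= C0 G + 3 * #|J|.
Proof.
have [r con le] := join_labelled model_connected (@union_embedding _ mdl)
  (@union_image _ mdl) None.
exists (union_graph r); last by rewrite union_C0.
have pt j : exists x : mdl j, True by have [] :=
  connected_conn (model_connected j).
have /fin_all_exists[x0 _] := pt.
split; first by apply: union_connected con _; exists (union_in (x0 None)).
exists (fun j => union_in (x0 j)); split=> [v|j].
  exists (tag v); split=> [|j];
    rewrite (@union_bubble _ mdl r model_connected) inE //.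
  by move/eqP.
exact: (@union_bubble_isomorphic _ mdl r model_connected (union_in (x0 j))).
Qed.

(** The +3 cancels against the marked copy among the [#|J|] bubbles, so only the copies of the
    [Bs i] carry a -3. *)
Lemma sum_C1_class :
  ((C1 B)%:Z + \sum_(i < N) (n i)%:Z * ((C1 (Bs i))%:Z - 3%:Z))%R
  = ((\sum_j C1 (mdl j))%:Z + 3%:Z - (3 * #|J|)%:Z)%R.
Proof.
have -> : #|J| = 1 + \sum_(i < N) n i.
  rewrite -sum1_card sum_label; congr (_ + _); apply: eq_bigr => i _.
  by rewrite sum1_card card_ord.
have -> : \sum_j C1 (mdl j) = C1 B + \sum_(i < N) n i * C1 (Bs i).
  rewrite sum_label; congr (_ + _); apply: eq_bigr => i _.
  by rewrite (eq_bigr (fun=> C1 (Bs i))) // sum_nat_const card_ord.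
have Posz_sum (F : 'I_N -> nat) : ((\sum_i F i)%N%:Z = \sum_i (F i)%:Z)%R.
  by rewrite (big_morph Posz PoszD (erefl (Posz 0))).
have -> : (\sum_(i < N) (n i)%:Z * ((C1 (Bs i))%:Z - 3%:Z)
    = (\sum_(i < N) n i * C1 (Bs i))%N%:Z - 3%:Z * (\sum_(i < N) n i)%N%:Z)%R.
  rewrite !Posz_sum mulr_sumr -sumrB; apply: eq_bigr => i _.
  by rewrite PoszM mulrBr [X in (_ - X)%R]mulrC.
lia.
Qed.

End Class.

Theorem theorem5 (N : nat) (Bs : 'I_N -> ecgraph 'I_3) (n : 'I_N -> nat)
    (B : ecgraph 'I_3)
    (Bs_connected : forall i, is_connected (Bs i))
    (Bs_planar : forall i, planar (Bs i))
    (n_gt0 : forall i, 0 < n i)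
    (B_connected : is_connected B) :
  (forall G : ecgraph 'I_4, in_class Bs n B G ->
     (in_class_max Bs n B G <-> forall v : G, max_2cut v)) /\
  max_C0_is Bs n B
    ((C1 B)%:Z + \sum_(i < N) (n i)%:Z * ((C1 (Bs i))%:Z - 3%:Z))%R.
Proof.
have con := @model_connected N Bs n B Bs_connected B_connected.
have pl := @planar_model N Bs n B Bs_planar.
have bound := @leq_C0_class N Bs n B Bs_connected B_connected Bs_planar.
have [G0 cG0 maxG0] := max_C0_class n Bs_connected B_connected.
split=> [G cG|].
  have [h [lab [emb im]]] := class_labels cG.
  have [conG _] := cG.
  split=> [[_ maxG]|cut2].
    apply: (max_2cut_of_max conG con pl emb im).
    (* It suffices to compare [G] with the constructed [G0], which attains the bound. *)
    by apply: leq_trans maxG0 _; rewrite leq_add2r; apply: maxG.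
  split=> // G' /bound le'; rewrite -(leq_add2r (3 * #|label n|)).
  by apply: leq_trans le' _; apply: (max_of_max_2cut None conG con emb im).
rewrite (@sum_C1_class N Bs n B); split; last by move=> G /bound; lia.
by exists G0 => //; move: maxG0 (bound _ cG0); lia.
Qed.
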